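(* Let $K$ be a field, $Q$ a finite quiver with vertex set $I$, and let $i,j\in I$ be loop-free vertices. Then for every $\lambda\in K^I$: (i) If there is no arrow between $i$ and $j$ in $Q$, there are isomorphisms of functors $C_i^{r_j\lambda}C_j^{\lambda}\cong C_j^{r_i\lambda}C_i^{\lambda}$ and $K_i^{r_j\lambda}K_j^{\lambda}\cong K_j^{r_i\lambda}K_i^{\lambda}$. (ii) If there is exactly one arrow between $i$ and $j$ in $Q$, there are isomorphisms of functors $C_i^{r_jr_i\lambda}C_j^{r_i\lambda}C_i^{\lambda}\cong C_j^{r_ir_j\lambda}C_i^{r_j\lambda}C_j^{\lambda}$ and $K_i^{r_jr_i\lambda}K_j^{r_i\lambda}K_i^{\lambda}\cong K_j^{r_ir_j\lambda}K_i^{r_j\lambda}K_j^{\lambda}$. Here $C_i^\lambda,K_i^\lambda:\mathrm{Mod}\,\Pi^\lambda(Q)\to\mathrm{Mod}\,\Pi^{r_i\lambda}(Q)$ are the cokernel and kernel reflection functors.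
   Context: Modules are left modules. For a finite quiver $Q$ with vertex set $I$, $h(a),t(a)$ are the head and tail of an arrow $a$. The double $\overline{Q}$ is obtained by adjoining $a^*:j\to i$ for each $a:i\to j$ in $Q$; $(a^* )^*=a$; $\epsilon(a)=1$ if $a\in Q_1$ and $\epsilon(a)=-1$ for $a\in\overline{Q}_1\setminus Q_1$. Paths: $ba$ exists if $h(a)=t(b)$. $\Pi^\lambda(Q)=K\overline{Q}/(\sum_{a\in\overline{Q}_1}\epsilon(a)aa^*-\sum_{i\in I}\lambda_ie_i)$. A $\Pi^\lambda(Q)$-module is the same as a representation $V=(V_j,V_a)$: vector spaces $V_j$ ($j\in I$), linear maps $V_a:V_{t(a)}\to V_{h(a)}$ ($a\in\overline{Q}_1$) with $\sum_{a\in\overline{Q}_1,\,h(a)=j}\epsilon(a)V_aV_{a^*}=\lambda_j\,\mathrm{id}_{V_j}$ for all $j$. Vertex $i$ is loop-free if no arrow has head and tail both $i$. Let $\langle\alpha,\beta\rangle=\sum_{i}\alpha_i\beta_i-\sum_{a\in Q_1}\alpha_{t(a)}\beta_{h(a)}$, $(\alpha,\beta)=\langle\alpha,\beta\rangle+\langle\beta,\alpha\rangle$, $\epsilon_j$ the $j$th coordinate vector; $r_i$ acts on $K^I$ by $(r_i\lambda)_j=\lambda_j-(\epsilon_i,\epsilon_j)\lambda_i$. If there is no arrow between $i$ and $j$ then $r_ir_j=r_jr_i$; if there is exactly one then $r_ir_jr_i=r_jr_ir_j$. Fix $i$ loop-free and a representation $V$ of $\Pi^\lambda(Q)$. Let $V_\oplus=\bigoplus_{a\in\overline{Q}_1,\,h(a)=i}V_{t(a)}$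 with canonical inclusions $\mu_a:V_{t(a)}\to V_\oplus$ and projections $\pi_a:V_\oplus\to V_{t(a)}$; let $\mu=\sum_{h(a)=i}\mu_aV_{a^*}:V_i\to V_\oplus$ and $\pi=\sum_{h(a)=i}\epsilon(a)V_a\pi_a:V_\oplus\to V_i$. Then $\pi\mu=\lambda_i\,\mathrm{id}_{V_i}$. $C_i^\lambda(V)$: $C_i^\lambda(V)_j=V_j$ for $j\ne i$, $C_i^\lambda(V)_i=\mathrm{Coker}(\mu)$ with quotient map $c:V_\oplus\to C_i^\lambda(V)_i$; let $\gamma:C_i^\lambda(V)_i\to V_\oplus$ be the unique map with $\gamma c=\mu\pi-\lambda_i\,\mathrm{id}$. For $a\in\overline{Q}_1$: $C_i^\lambda(V)_a=V_a$ if $h(a)\ne i\ne t(a)$; $=\epsilon(a)c\mu_a$ if $h(a)=i$; $=\pi_{a^*}\gamma$ if $t(a)=i$. On a morphism $f$: $C_i^\lambda(f)_j=f_j$ for $j\neq i$, and $C_i^\lambda(f)_i$ is the map induced on cokernels by $\bigoplus_{h(a)=i}f_{t(a)}$. $K_i^\lambda(V)$: $K_i^\lambda(V)_j=V_j$ for $j\neq i$, $K_i^\lambda(V)_i=\mathrm{Ker}(\pi)$ with inclusion $\iota$ into $V_\oplus$; let $\gamma':V_\oplus\to K_i^\lambda(V)_i$ be the unique map with $\iota\gamma'=\mu\pi-\lambda_i\,\mathrm{id}$. For $a\in\overline{Q}_1$: $K_i^\lambda(V)_a=V_a$ if $h(a)\neq i\neq t(a)$; $=\epsilon(a)\gamma'\mu_a$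 if $h(a)=i$; $=\pi_{a^*}\iota$ if $t(a)=i$. On morphisms, $K_i^\lambda(f)_j=f_j$ for $j\ne i$ and $K_i^\lambda(f)_i$ is the induced map on kernels. These define functors $\mathrm{Mod}\,\Pi^\lambda(Q)\to\mathrm{Mod}\,\Pi^{r_i\lambda}(Q)$. *)

(* Defs.v *)
From HB Require Import structures.
From mathcomp Require Import all_boot all_order all_algebra.
From mathcomp Require Import boolp ring.

Set Implicit Arguments.
Unset Strict Implicit.
Unset Printing Implicit Defensive.

Import GRing.Theory.
Local Open Scope ring_scope.

Record category := Category {
  cobj :> Type;
  chom : cobj -> cobj -> Type;
  cid : forall x, chom x x;
  ccomp : forall x y z, chom y z -> chom x y -> chom x z;
  ccomp1 : forall x y (f : chom x y), ccomp f (cid x) = f;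
  ccomp1f : forall x y (f : chom x y), ccomp (cid y) f = f;
  ccompA : forall x y z t (h : chom z t) (g : chom y z) (f : chom x y),
    ccomp h (ccomp g f) = ccomp (ccomp h g) f
}.
Arguments chom {c} x y.
Arguments cid {c} x.
Arguments ccomp {c x y z} g f.

Record functor (A B : category) := Functor {
  fobj :> A -> B;
  fmap : forall x y : A, chom x y -> chom (fobj x) (fobj y);
  fmap1 : forall x, fmap (cid x) = cid (fobj x);
  fmapM : forall x y z (g : chom y z) (f : chom x y),
    fmap (ccomp g f) = ccomp (fmap g) (fmap f)
}.
Arguments fmap {A B} _ {x y} _.

Section FunctorComp.
Variables (A B C : category) (G : functor B C) (F : functor A B).

Definition fcomp_map (x y : A) (f : chom x y) : chom (G (F x)) (G (F y)) :=
  fmap G (fmap F f).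

Fact fcomp_map1 x : fcomp_map (cid x) = cid (G (F x)).
Proof. by rewrite /fcomp_map !fmap1. Qed.

Fact fcomp_mapM x y z (g : chom y z) (f : chom x y) :
  fcomp_map (ccomp g f) = ccomp (fcomp_map g) (fcomp_map f).
Proof. by rewrite /fcomp_map !fmapM. Qed.

Definition fcomp : functor A C := Functor fcomp_map1 fcomp_mapM.

End FunctorComp.

Notation "G \of F" := (fcomp G F)
  (at level 50, left associativity, format "G  \of  F").

Definition is_iso (A : category) (x y : A) (f : chom x y) : Prop :=
  exists g : chom y x, ccomp g f = cid x /\ ccomp f g = cid y.

Definition functor_iso (A B : category) (F G : functor A B) : Prop :=
  exists eta : forall x : A, chom (F x) (G x),
    (forall x, is_iso (eta x)) /\
    (forall (x y : A) (f : chom x y),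
       ccomp (eta y) (fmap F f) = ccomp (fmap G f) (eta x)).

Section Linear.
Variable K : fieldType.

Definition lin (U W : lmodType K) (f : U -> W) (lf : linear f)
  : {linear U -> W} := HB.pack f (GRing.isLinear.Build K U W _ f lf).

Lemma linE (U W : lmodType K) (f : U -> W) (lf : linear f) x : lin lf x = f x.
Proof. by []. Qed.

Lemma lin_ext (U W : lmodType K) (f g : {linear U -> W}) : f =1 g -> f = g.
Proof.
move=> /funext; case: f g => f [[fc] [fs]] [g [[gc] [gs]]] /= e.
rewrite -{}e {g} in gc gs *.
by rewrite (Prop_irrelevance gc fc) (Prop_irrelevance gs fs).
Qed.

(* Finite direct sum of a family of vector spaces. *)
Section DirectSum.
Variables (J : finType) (V : J -> lmodType K).

Definition dsum : Type := {dffun forall j, V j}.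
HB.instance Definition _ := Choice.on dsum.
Implicit Types x y z : dsum.

Definition dsum_add x y : dsum := [ffun j => x j + y j].
Definition dsum_zero : dsum := [ffun j => 0].
Definition dsum_opp x : dsum := [ffun j => - x j].
Definition dsum_scale (a : K) x : dsum := [ffun j => a *: x j].

Fact dsum_addA : associative dsum_add.
Proof. by move=> x y z; apply/ffunP=> j; rewrite !ffunE addrA. Qed.
Fact dsum_addC : commutative dsum_add.
Proof. by move=> x y; apply/ffunP=> j; rewrite !ffunE addrC. Qed.
Fact dsum_add0 : left_id dsum_zero dsum_add.
Proof. by move=> x; apply/ffunP=> j; rewrite !ffunE add0r. Qed.
Fact dsum_addN : left_inverse dsum_zero dsum_opp dsum_add.
Proof. by move=> x; apply/ffunP=> j; rewrite !ffunE addNr. Qed.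
HB.instance Definition _ :=
  GRing.isZmodule.Build dsum dsum_addA dsum_addC dsum_add0 dsum_addN.

Fact dsum_scaleA a b x : dsum_scale a (dsum_scale b x) = dsum_scale (a * b) x.
Proof. by apply/ffunP=> j; rewrite !ffunE scalerA. Qed.
Fact dsum_scale1 : left_id 1 dsum_scale.
Proof. by move=> x; apply/ffunP=> j; rewrite !ffunE scale1r. Qed.
Fact dsum_scaleDr : right_distributive dsum_scale +%R.
Proof. by move=> a x y; apply/ffunP=> j; rewrite !ffunE scalerDr. Qed.
Fact dsum_scaleDl x : {morph dsum_scale^~ x : a b / a + b}.
Proof. by move=> a b; apply/ffunP=> j; rewrite !ffunE scalerDl. Qed.
HB.instance Definition _ := GRing.Zmodule_isLmodule.Build K dsum
  dsum_scaleA dsum_scale1 dsum_scaleDr dsum_scaleDl.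

Lemma dsumP x y : (forall j, x j = y j) -> x = y.
Proof. by move=> e; apply/ffunP. Qed.
Lemma dsumDE x y j : (x + y) j = x j + y j. Proof. exact: ffunE. Qed.
Lemma dsum0E j : (0 : dsum) j = 0. Proof. exact: ffunE. Qed.
Lemma dsumNE x j : (- x) j = - x j. Proof. exact: ffunE. Qed.
Lemma dsumZE a x j : (a *: x) j = a *: x j. Proof. exact: ffunE. Qed.

Definition dproj_fun j (x : dsum) : V j := x j.
Fact dproj_linear j : linear (dproj_fun j).
Proof. by move=> a x y; rewrite /dproj_fun dsumDE dsumZE. Qed.
Definition dproj j : {linear dsum -> V j} := lin (dproj_linear j).

Definition dinj_fun j (v : V j) : dsum := [ffun k => dfwith (fun i => 0 : V i) v k].
Lemma dinj_fun_eq j (v : V j) : dinj_fun v j = v.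
Proof. by rewrite ffunE dfwith_in. Qed.
Lemma dinj_fun_neq j (v : V j) k : j != k -> dinj_fun v k = 0.
Proof. by move=> jk; rewrite ffunE dfwith_out. Qed.
Fact dinj_linear j : linear (@dinj_fun j).
Proof.
move=> a u v; apply: dsumP => k; rewrite dsumDE dsumZE.
have [<-|jk] := eqVneq j k; first by rewrite !dinj_fun_eq.
by rewrite !dinj_fun_neq // scaler0 addr0.
Qed.
Definition dinj j : {linear V j -> dsum} := lin (@dinj_linear j).

Lemma dsum_sumE (T : finType) (F : T -> dsum) j :
  (\sum_t F t) j = \sum_t F t j.
Proof. exact: (linear_sum (dproj j)). Qed.

Lemma dinj_eq j (v : V j) : dinj j v j = v.
Proof. exact: dinj_fun_eq. Qed.
Lemma dinj_neq j (v : V j) k : j != k -> dinj j v k = 0.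
Proof. exact: dinj_fun_neq. Qed.

Lemma sum_dinjE (F : forall j, V j) k : (\sum_j dinj j (F j)) k = F k.
Proof.
rewrite dsum_sumE (bigD1 k) //= dinj_eq big1 ?addr0 // => j jk.
exact: dinj_neq.
Qed.

Lemma dsum_decomp x : x = \sum_j dinj j (x j).
Proof. by apply: dsumP => k; rewrite (sum_dinjE (fun j => x j)). Qed.

End DirectSum.

Section KerCoker.
Variables (U W : lmodType K) (f : {linear U -> W}).

Definition ker_pred : pred U := fun x => f x == 0.
Fact ker_submod : submod_closed ker_pred.
Proof.
split=> [|a x y]; rewrite !unfold_in ?linear0 // => /eqP fx /eqP fy.
by rewrite linearP fx fy scaler0 addr0.
Qed.
HB.instance Definition _ := GRing.isSubmodClosed.Build K U ker_pred ker_submod.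
Record ker : Type := Ker { ker_val : U; _ : ker_val \in ker_pred }.
HB.instance Definition _ := [isSub for ker_val].
HB.instance Definition _ := [Choice of ker by <:].
HB.instance Definition _ := [SubChoice_isSubLmodule of ker by <:].

Definition im_pred : {pred W} := fun y => `[< exists x, y = f x >].
Lemma im_predP y : reflect (exists x, y = f x) (y \in im_pred).
Proof. exact: asboolP. Qed.
Fact im_submod : submod_closed im_pred.
Proof.
split=> [|a y1 y2]; first by apply/im_predP; exists 0; rewrite linear0.
move=> /im_predP[x1 ->] /im_predP[x2 ->]; apply/im_predP.
by exists (a *: x1 + x2); rewrite linearP.
Qed.
HB.instance Definition _ :=
  GRing.isSubmodClosed.Build K W im_pred im_submod.
HB.instance Definition _ :=
  GRing.isOppClosed.Build W im_pred (GRing.zmod_closedN (GRing.submod_closedB im_submod)).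


Definition kincl_fun (x : ker) : U := \val x.
Fact kincl_linear : linear kincl_fun.
Proof. by []. Qed.
Definition kincl : {linear ker -> U} := lin kincl_linear.

Lemma kincl_inj : injective kincl.
Proof. exact: val_inj. Qed.
Lemma kinclP (x : ker) : f (kincl x) = 0.
Proof. exact/eqP/(valP x). Qed.

Section KerLift.
Variables (T : lmodType K) (g : {linear T -> U}) (fg0 : forall t, f (g t) = 0).
Fact klift_subproof t : g t \in ker_pred.
Proof. by rewrite unfold_in fg0. Qed.
Definition klift_fun t : ker := Ker (klift_subproof t).
Fact klift_linear : linear klift_fun.
Proof. by move=> a x y; apply: val_inj; rewrite /= linearP. Qed.
Definition klift : {linear T -> ker} := lin klift_linear.
Lemma kliftE t : kincl (klift t) = g t. Proof. by []. Qed.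
End KerLift.

Definition im_zmod : zmodClosed W := im_pred.
Definition coker : Type := Quotient.quot im_zmod.
HB.instance Definition _ := GRing.Zmodule.on coker.

Definition cproj_fun (y : W) : coker := 
  (\pi_(Quotient.quot im_zmod) y)%qT.
Definition crepr (q : coker) : W := repr (q : Quotient.quot im_zmod).

Lemma creprK q : cproj_fun (crepr q) = q.
Proof. exact: reprK. Qed.
Lemma cproj_fun_eq y z : cproj_fun y = cproj_fun z <-> y - z \in im_pred.
Proof.
rewrite (Quotient.idealrBE im_zmod).
by split=> [e|/eqP]; [apply/eqP|].
Qed.
Lemma cproj_funD y z : cproj_fun (y + z) = cproj_fun y + cproj_fun z.
Proof. exact: raddfD. Qed.

Definition coker_scale (a : K) (q : coker) : coker := cproj_fun (a *: crepr q).
Lemma coker_scaleE a y : coker_scale a (cproj_fun y) = cproj_fun (a *: y).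
Proof.
by apply/cproj_fun_eq; rewrite -scalerBr rpredZ //; apply/cproj_fun_eq/creprK.
Qed.

Fact coker_scaleA a b q :
  coker_scale a (coker_scale b q) = coker_scale (a * b) q.
Proof. by rewrite -(creprK q) !coker_scaleE scalerA. Qed.
Fact coker_scale1 : left_id 1 coker_scale.
Proof. by move=> q; rewrite -(creprK q) coker_scaleE scale1r. Qed.
Fact coker_scaleDr : right_distributive coker_scale +%R.
Proof.
move=> a p q; rewrite -(creprK p) -(creprK q).
by rewrite -cproj_funD !coker_scaleE scalerDr cproj_funD.
Qed.
Fact coker_scaleDl q : {morph coker_scale^~ q : a b / a + b}.
Proof.
by move=> a b; rewrite -(creprK q) !coker_scaleE scalerDl cproj_funD.
Qed.
HB.instance Definition _ := GRing.Zmodule_isLmodule.Build K coker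
  coker_scaleA coker_scale1 coker_scaleDr coker_scaleDl.

Fact cproj_linear : linear cproj_fun.
Proof. by move=> a y z; rewrite cproj_funD -coker_scaleE. Qed.
Definition cproj : {linear W -> coker} := lin cproj_linear.

Lemma cproj_surj q : exists y, q = cproj y.
Proof. by exists (crepr q); rewrite linE creprK. Qed.
Lemma cprojP x : cproj (f x) = 0.
Proof.
by rewrite -(linear0 cproj); apply/cproj_fun_eq/im_predP; exists x; rewrite subr0.
Qed.

Section CokerDesc.
Variables (T : lmodType K) (g : {linear W -> T}) (gf0 : forall x, g (f x) = 0).
Definition cdesc_fun (q : coker) : T := g (crepr q).
Lemma cdesc_funE y : cdesc_fun (cproj y) = g y.
Proof.
have /cproj_fun_eq/im_predP[x e] := creprK (cproj y).
by apply/eqP; rewrite /cdesc_fun -subr_eq0 -linearB e gf0.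
Qed.
Fact cdesc_linear : linear cdesc_fun.
Proof.
move=> a p q; have [y ->] := cproj_surj p; have [z ->] := cproj_surj q.
by rewrite -linearP !cdesc_funE linearP.
Qed.
Definition cdesc : {linear coker -> T} := lin cdesc_linear.
Lemma cdescE y : cdesc (cproj y) = g y. Proof. exact: cdesc_funE. Qed.
End CokerDesc.

End KerCoker.
End Linear.

Arguments dinj {K J V} j.
Arguments dproj {K J V} j.

Record quiver := Quiver {
  vertex :> finType;
  arrow : finType;
  tail : arrow -> vertex;
  head : arrow -> vertex
}.
Arguments tail {q} a.
Arguments head {q} a.

Definition arr (Q : quiver) (k l : Q) : finType :=
  {a : arrow Q | (tail a == k) && (head a == l)}.

(* [inl a] is the arrow [a] of Q, [inr a] the adjoined reverse arrow. *)
Definition double (Q : quiver) : quiver :=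
  @Quiver Q (arrow Q + arrow Q)%type
    (fun a => match a with inl b => tail b | inr b => head b end)
    (fun a => match a with inl b => head b | inr b => tail b end).

Notation darr := (@arr (double _)).

Section Double.
Variable Q : quiver.

Definition flip (a : arrow (double Q)) : arrow (double Q) :=
  match a with inl b => inr b | inr b => inl b end.

Fact flip_subproof (k l : Q) (a : darr k l) :
  (tail (flip (val a)) == l) && (head (flip (val a)) == k).
Proof. by case: a => -[] b /= /andP[-> ->]. Qed.

Definition star (k l : Q) (a : darr k l)
  : darr l k := Sub (flip (val a)) (flip_subproof a).

Lemma starK k l : cancel (@star k l) (@star l k).
Proof. by move=> a; apply: val_inj; case: a => -[]. Qed.

Definition eps_arrow (K : fieldType) (a : arrow (double Q)) : K :=
  match a with inl _ => 1 | inr _ => -1 end.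

(* The arrows of the double with given head, paired with their tail. *)
Definition into (l : Q) : finType := {k : Q & darr k l}.
Definition to_into (k l : Q) (a : darr k l) : into l :=
  Tagged (fun k => darr k l) a.

Definition eps (K : fieldType) (k l : Q) (a : darr k l) : K :=
  eps_arrow K (val a).

Lemma eps_star (K : fieldType) k l (a : darr k l) :
  eps K (star a) = - eps K a.
Proof. by case: a => -[] b e; rewrite /eps /= ?opprK. Qed.

Lemma eps_sq (K : fieldType) k l (a : darr k l) :
  eps K a * eps K a = 1.
Proof. by case: a => -[] b e; rewrite /eps /= ?mulrNN mulr1. Qed.

Definition loopfree (i : Q) : Prop :=
  forall a : arrow Q, ~~ ((tail a == i) && (head a == i)).

Definition arrows_between (i j : Q) : {set arrow Q} :=
  [set a | ((tail a == i) && (head a == j)) || ((tail a == j) && (head a == i))].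

Definition ringel (al be : {ffun Q -> int}) : int :=
  \sum_i al i * be i - \sum_(a : arrow Q) al (tail a) * be (head a).

Definition symform (al be : {ffun Q -> int}) : int :=
  ringel al be + ringel be al.

Definition coord (j : Q) : {ffun Q -> int} := [ffun k => (k == j)%:R].

Definition wrefl (K : fieldType) (i : Q) (lam : {ffun Q -> K}) : {ffun Q -> K} :=
  [ffun j => lam j - (symform (coord i) (coord j))%:~R * lam i].

Lemma ringel_coord i j :
  ringel (coord i) (coord j) = (i == j)%:R - #|arr i j|%:R.
Proof.
rewrite /ringel; congr (_ - _).
  rewrite (bigD1 i) //= big1 ?addr0 => [|k /negbTE ki]; rewrite !ffunE.
    by rewrite eqxx mul1r.
  by rewrite ki mul0r.
rewrite card_sig -sum1_card natr_sum [RHS]big_mkcond /=.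
by apply: eq_bigr => a _; rewrite !ffunE -natrM mulnb inE; case: (_ && _).
Qed.

Lemma card_double_arr (i j : Q) :
  #|darr i j| = (#|arr i j| + #|arr j i|)%N.
Proof.
rewrite !card_sig -!sum1_card big_sumType /=; congr (_ + _)%N.
by apply: eq_bigl => a; rewrite !inE andbC.
Qed.

Lemma symform_coord i j :
  symform (coord i) (coord j) =
    (i == j)%:R *+ 2 - (#|darr i j|)%:R.
Proof.
rewrite /symform !ringel_coord (eq_sym j i) card_double_arr natrD mulr2n.
by rewrite addrACA -opprD.
Qed.

Lemma sum_into (M : nmodType) (j : Q) (F : forall k : Q, darr k j -> M) :
  \sum_(a : into j) F (tag a) (tagged a) = \sum_(k : Q) \sum_(a : darr k j) F k a.
Proof. by rewrite (sig_big_dep predT (fun _ => predT) F) /=. Qed.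

Lemma card_loopfree (i : Q) : loopfree i -> #|(@arr (double Q) i i)| = 0%N.
Proof.
move=> li; rewrite card_double_arr card_sig eq_card0 // => a.
by rewrite inE; apply/negbTE/li.
Qed.

End Double.

Section Representations.
Variables (K : fieldType) (Q : quiver).

Record rep := Rep {
  rsp :> Q -> lmodType K;
  rmap : forall k l, arr k l -> {linear rsp k -> rsp l}
}.
Arguments rmap r {k l} a.

Record rhom (V W : rep) := RHom {
  rh :> forall k, {linear V k -> W k};
  rhP : forall k l (a : arr k l) x, rh l (rmap V a x) = rmap W a (rh k x)
}.

Lemma rhom_ext (V W : rep) (f g : rhom V W) :
  (forall k, f k =1 g k) -> f = g.
Proof.
case: f g => f fP [g gP] /= fg.
have e : f = g by apply: functional_extensionality_dep => k; exact/lin_ext/fg.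
by subst g; rewrite (Prop_irrelevance gP fP).
Qed.

Section Id.
Variable V : rep.
Definition rid_fun k (x : V k) : V k := x.
Fact rid_linear k : linear (@rid_fun k). Proof. by []. Qed.
Definition rid : rhom V V :=
  @RHom V V (fun k => lin (@rid_linear k)) (fun k l a x => erefl).
End Id.

Section Comp.
Variables (U V W : rep) (g : rhom V W) (f : rhom U V).
Definition rcomp_fun k (x : U k) : W k := g k (f k x).
Fact rcomp_linear k : linear (@rcomp_fun k).
Proof. by move=> a x y; rewrite /rcomp_fun !linearP. Qed.
Fact rcomp_subproof k l (a : arr k l) x :
  lin (@rcomp_linear l) (rmap U a x) = rmap W a (lin (@rcomp_linear k) x).
Proof. by rewrite !linE /rcomp_fun !rhP. Qed.
Definition rcomp : rhom U W := RHom rcomp_subproof.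
Lemma rcompE k x : rcomp k x = g k (f k x). Proof. by []. Qed.
End Comp.

End Representations.
Arguments rmap {K Q} r {k l} a.

Section Preprojective.
Variables (K : fieldType) (Q : quiver).
Local Notation rep := (rep K (double Q)).

Definition preproj (lam : {ffun Q -> K}) (V : rep) : Prop :=
  forall (j : Q) (x : V j),
    \sum_(a : into j)
      eps K (tagged a) *: rmap V (tagged a) (rmap V (star (tagged a)) x)
    = lam j *: x.

Record pirep (lam : {ffun Q -> K}) := PiRep {
  pirep_rep :> rep;
  pirepP : preproj lam pirep_rep
}.

Definition ModPi (lam : {ffun Q -> K}) : category.
Proof.
refine (@Category (pirep lam) (fun V W => rhom V W) (fun V => rid V)
  (fun U V W g f => rcomp g f) _ _ _).
- by move=> V W f; apply: rhom_ext.
- by move=> V W f; apply: rhom_ext.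
- by move=> U V W X h g f; apply: rhom_ext.
Defined.

(* Mod Pi^lam and Mod Pi^mu coincide when lam = mu; this is the identity
   functor between them. *)
Section Transport.
Variables (lam mu : {ffun Q -> K}) (e : lam = mu).
Fact mod_cast_subproof (V : pirep lam) : preproj mu V.
Proof. by rewrite -e; apply: pirepP. Qed.
Definition mod_cast : functor (ModPi lam) (ModPi mu) :=
  @Functor (ModPi lam) (ModPi mu) (fun V : pirep lam => PiRep (@mod_cast_subproof V))
    (fun V W f => f) (fun=> erefl) (fun _ _ _ _ _ => erefl).
End Transport.

Variable i : Q.

Section Oplus.
Variable V : rep.

Definition oplus := dsum (fun a : into i => V (tag a)).

Definition mu_fun (x : V i) : oplus :=
  \sum_(a : into i) dinj a (rmap V (star (tagged a)) x).
Fact mu_linear : linear mu_fun.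
Proof.
move=> c x y; rewrite /mu_fun scaler_sumr -big_split.
by apply: eq_bigr => a _; rewrite !linearP.
Qed.
Definition mu : {linear V i -> oplus} := lin mu_linear.

Definition pi_fun (y : oplus) : V i :=
  \sum_(a : into i) eps K (tagged a) *: rmap V (tagged a) (dproj a y).
Fact pi_linear : linear pi_fun.
Proof.
move=> c x y; rewrite /pi_fun scaler_sumr -big_split.
apply: eq_bigr => a _.
by rewrite (linearP (dproj a)) (linearP (rmap V _)) scalerDr !scalerA mulrC.
Qed.
Definition pi : {linear oplus -> V i} := lin pi_linear.

Lemma muE x a : mu x a = rmap V (star (tagged a)) x.
Proof. 
exact: (@sum_dinjE K (into i) (fun b => V (tag b))
  (fun b => rmap V (star (tagged b)) x)). Qed.

Lemma piE y : 
  pi y = \sum_(a : into i) eps K (tagged a) *: rmap V (tagged a) (y a).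
Proof. by []. Qed.

Lemma pi_dinj a x : pi (dinj a x) = eps K (tagged a) *: rmap V (tagged a) x.
Proof.
rewrite piE (bigD1 a) //= dinj_eq big1 ?addr0 // => b ba.
by rewrite dinj_neq 1?eq_sym // linear0 scaler0.
Qed.

Lemma pi_mu lam x : preproj lam V -> pi (mu x) = lam i *: x.
Proof.
by move=> VP; rewrite -VP piE; apply: eq_bigr => a _; rewrite muE.
Qed.

(* mu pi - lam_i id *)
Definition mupi_fun (lam : {ffun Q -> K}) (y : oplus) : oplus :=
  mu (pi y) - lam i *: y.
Fact mupi_linear lam : linear (mupi_fun lam).
Proof.
move=> c x y; rewrite /mupi_fun (linearP (pi)) (linearP mu) scalerBr scalerDr !scalerA mulrC.
by rewrite opprD addrACA.
Qed.
Definition mupi lam : {linear oplus -> oplus} := lin (mupi_linear lam).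
Lemma mupiE lam y : mupi lam y = mu (pi y) - lam i *: y. Proof. by []. Qed.

Lemma pi_mupi lam y : preproj lam V -> pi (mupi lam y) = 0.
Proof. by move=> VP; rewrite mupiE linearB linearZ (pi_mu _ VP) subrr. Qed.
Lemma mupi_mu lam x : preproj lam V -> mupi lam (mu x) = 0.
Proof. by move=> VP; rewrite mupiE (pi_mu _ VP) linearZ subrr. Qed.

End Oplus.

Section OplusMap.
Variables (V W : rep) (f : rhom V W).
Definition omap_fun (y : oplus V) : oplus W := [ffun a => f (tag a) (y a)].
Lemma omap_funE y a : omap_fun y a = f (tag a) (y a).
Proof. exact: ffunE. Qed.
Fact omap_linear : linear omap_fun.
Proof.
move=> c x y; apply: dsumP => a.
by rewrite dsumDE dsumZE !omap_funE dsumDE dsumZE linearP.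
Qed.
Definition omap : {linear oplus V -> oplus W} := lin omap_linear.
Lemma omapE y a : omap y a = f (tag a) (y a).
Proof. exact: ffunE. Qed.
Lemma omap_mu x : omap (mu V x) = mu W (f i x).
Proof. by apply: dsumP => a; rewrite omapE !muE rhP. Qed.
Lemma pi_omap y : pi W (omap y) = f i (pi V y).
Proof.
rewrite !piE linear_sum; apply: eq_bigr => a _.
by rewrite omapE linearZ rhP.
Qed.
Lemma omap_mupi lam y : omap (mupi V lam y) = mupi W lam (omap y).
Proof. by rewrite !mupiE linearB linearZ omap_mu pi_omap. Qed.
Lemma omap_dinj a x : omap (dinj a x) = dinj a (f (tag a) x).
Proof.
apply: dsumP => b; rewrite omapE.
have [<-|ab] := eqVneq a b; first by rewrite !dinj_eq.
by rewrite !dinj_neq // linear0.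
Qed.
End OplusMap.

(* The representation obtained from V by putting N at i, where the arrows with
   head i are given by p and the arrows with tail i by s. Equality with i is
   analysed through [i =P j], as the space at j depends on it. *)
Section Replace.
Variables (V : rep) (N : lmodType K).
Variables (p : {linear oplus V -> N}) (s : {linear N -> oplus V}).

Definition rsp_at j b (r : reflect (i = j) b) : lmodType K :=
  match r with ReflectT _ => N | ReflectF _ => V j end.

Definition in_fun k (a : darr k i) (x : V k) : N :=
  eps K a *: p (dinj (to_into a) x).
Fact in_linear k a : linear (@in_fun k a).
Proof. by move=> c x y; rewrite /in_fun (linearP (dinj _)) (linearP p) scalerDr !scalerA mulrC. Qed.

Definition out_fun l (a : darr i l) (n : N) : V l :=
  dproj (to_into (star a)) (s n).
Fact out_linear l a : linear (@out_fun l a).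
Proof. by move=> c x y; rewrite /out_fun !linearP. Qed.

Definition zero_fun (n : N) : N := 0.
Fact zero_linear : linear zero_fun.
Proof. by move=> c x y; rewrite /zero_fun scaler0 addr0. Qed.

(* The last branch is void when i is loop-free. *)
Definition rmap_at k l (a : darr k l)
    bk (rk : reflect (i = k) bk) bl (rl : reflect (i = l) bl) :
    {linear rsp_at rk -> rsp_at rl} :=
  match rk, rl return {linear rsp_at rk -> rsp_at rl} with
  | ReflectF _, ReflectF _ => rmap V a
  | ReflectF _, ReflectT e => lin (in_linear (ecast z (darr k z) (esym e) a))
  | ReflectT e, ReflectF _ => lin (out_linear (ecast z (darr z l) (esym e) a))
  | ReflectT _, ReflectT _ => lin zero_linear
  end.

Definition replace : rep :=
  @Rep K (double Q) (fun j => rsp_at (i =P j))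
    (fun k l a => rmap_at a (i =P k) (i =P l)).

Section ReplacePreproj.
Variable lam : {ffun Q -> K}.
Hypotheses (li : loopfree i) (VP : preproj lam V).
Hypothesis sp : forall y, s (p y) = mupi V lam y.
Hypothesis ps : forall n, p (s n) = - lam i *: n.

Lemma replace_rel j b (r : reflect (i = j) b) (x : rsp_at r) :
  \sum_(a : into j) eps K (tagged a) *:
    rmap_at (tagged a) (i =P tag a) r
      (rmap_at (star (tagged a)) r (i =P tag a) x)
  = wrefl i lam j *: x.
Proof.
case: r x => [e|ne] /= x.
  case: j / e => /=.
  rewrite ffunE symform_coord eqxx card_loopfree // subr0 mulr2n.
  rewrite -[1 + 1]/(2%:R) mulrDl !mul1r opprD addNKr -ps.
  rewrite [in RHS](dsum_decomp (s x)) linear_sum.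
  apply: eq_bigr => -[k a] _ /=.
  case: (i =P k) => [e|ne] /=.
    case: k / e a => a; have := card_loopfree li.
    by move/card0_eq/(_ a).
  rewrite -[LHS]/(eps K a *: (eps K a *:
    p (dinj (to_into a) (dproj (to_into (star (star a))) (s x))))).
  by rewrite starK scalerA eps_sq scale1r.
transitivity (\sum_(a : into j) (eps K (tagged a) *:
    rmap V (tagged a) (rmap V (star (tagged a)) x) +
    (tag a == i)%:R *: (lam i *: x))).
  apply: eq_bigr => -[k a] _ /=.
  case: (i =P k) => [e|/nesym/eqP/negbTE nek] /=; last first.
    by rewrite nek scale0r addr0.
  case: k / e a => a; rewrite eqxx scale1r.
  rewrite -[LHS]/(eps K a *:
    s (eps K (star a) *: p (dinj (to_into (star a)) x)) (to_into (star a))).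
  rewrite (linearZZ s) dsumZE sp mupiE pi_dinj dsumDE dsumNE dsumZE dinj_eq.
  rewrite (linearZZ (mu V)) dsumZE muE /= starK eps_star.
  by rewrite scalerA mulrN eps_sq scaleN1r scaleNr opprB opprK addrC.
rewrite big_split -scaler_suml VP ffunE symform_coord.
have -> : (i == j) = false by apply/eqP.
have -> : \sum_(a : into j) (tag a == i)%:R = #|@arr (double Q) i j|%:R :> K.
  rewrite (sum_into (fun k _ => (k == i)%:R)) (bigD1 i) //= eqxx sumr_const.
  rewrite [X in _ + X]big1 ?addr0 // => k /negbTE ki.
  by apply: big1 => a _; rewrite ki.
rewrite mul0rn sub0r mulrNz mulNr opprK scalerDl scalerA.
by rewrite pmulrn natz.
Qed.

Definition replace_pirep : pirep (wrefl i lam) :=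
  @PiRep (wrefl i lam) replace (fun j x => replace_rel x).


End ReplacePreproj.
End Replace.

Section ReplaceMap.
Variables (V W : rep) (N M : lmodType K).
Variables (p : {linear oplus V -> N}) (s : {linear N -> oplus V}).
Variables (q : {linear oplus W -> M}) (t : {linear M -> oplus W}).
Variables (f : rhom V W) (n : {linear N -> M}).

Definition replace_map_at j b (r : reflect (i = j) b) :
    {linear rsp_at V N r -> rsp_at W M r} :=
  match r return {linear rsp_at V N r -> rsp_at W M r} with
  | ReflectT _ => n
  | ReflectF _ => f j
  end.

Hypothesis np : forall y, n (p y) = q (omap f y).
Hypothesis ns : forall x, omap f (s x) = t (n x).

Fact replace_map_subproof k l (a : darr k l) bk (rk : reflect (i = k) bk)
    bl (rl : reflect (i = l) bl) (x : rsp_at V N rk) :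
  replace_map_at rl (rmap_at p s a rk rl x)
    = rmap_at q t a rk rl (replace_map_at rk x).
Proof.
case: rk rl x => [ek|nk] [el|nl] x /=.
- exact: linear0.
- rewrite -[RHS]/(t (n x) (to_into (star (ecast z (darr z l) (esym ek) a)))).
  by rewrite -ns omapE.
- set b := ecast z (darr k z) (esym el) a.
  rewrite -[LHS]/(n (eps K b *: p (dinj (to_into b) x))).
  by rewrite linearZZ np omap_dinj.
- exact: rhP.
Qed.

Definition replace_map : rhom (replace p s) (replace q t) :=
  @RHom K (double Q) (replace p s) (replace q t)
    (fun j => replace_map_at (i =P j))
    (fun k l a => @replace_map_subproof k l a _ (i =P k) _ (i =P l)).

End ReplaceMap.

Lemma replace_map_at_id (V : rep) (N : lmodType K) (n : {linear N -> N}) j b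
    (r : reflect (i = j) b) (x : rsp_at V N r) :
  (forall y, n y = y) -> replace_map_at (rid V) n r x = x.
Proof. by move=> nE; case: r x => [e|ne] x //; apply: nE. Qed.

Lemma replace_map_at_comp (U V W : rep) (N M L : lmodType K)
    (g : rhom V W) (f : rhom U V) (m : {linear M -> L}) (n : {linear N -> M})
    (mn : {linear N -> L}) j b (r : reflect (i = j) b) (x : rsp_at U N r) :
  (forall y, mn y = m (n y)) ->
  replace_map_at (rcomp g f) mn r x =
    replace_map_at g m r (replace_map_at f n r x).
Proof. by move=> nE; case: r x => [e|ne] x //; apply: nE. Qed.

Section CokernelFunctor.
Variable lam : {ffun Q -> K}.
Hypothesis li : loopfree i.

Section Object.
Variable V : pirep lam.
Fact cgamma_subproof x : mupi V lam (mu V x) = 0.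
Proof. exact/mupi_mu/pirepP. Qed.
(* The map gamma, characterised by gamma c = mu pi - lam_i id. *)
Definition cgamma : {linear coker (mu V) -> oplus V} := cdesc cgamma_subproof.
Fact cgammaE y : cgamma (cproj (mu V) y) = mupi V lam y.
Proof. exact: cdescE. Qed.
Fact cproj_cgamma q : cproj (mu V) (cgamma q) = - lam i *: q.
Proof.
have [y ->] := cproj_surj q.
by rewrite cgammaE mupiE linearB cprojP linearZZ sub0r scaleNr.
Qed.
Definition cok_obj : pirep (wrefl i lam) :=
  replace_pirep li (@pirepP _ V) cgammaE cproj_cgamma.
End Object.

Section Morphism.
Variables (V W : pirep lam) (f : rhom V W).
Definition cok_ind_fun (y : oplus V) : coker (mu W) := cproj (mu W) (omap f y).
Fact cok_ind_linear : linear cok_ind_fun.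
Proof. by move=> c x y; rewrite /cok_ind_fun !linearP. Qed.
Fact cok_ind_subproof x : lin cok_ind_linear (mu V x) = 0.
Proof. by rewrite -[LHS]/(cproj _ (omap f (mu V x))) omap_mu cprojP. Qed.
Definition cok_ind : {linear coker (mu V) -> coker (mu W)} :=
  cdesc cok_ind_subproof.
Fact cok_indE y : cok_ind (cproj (mu V) y) = cproj (mu W) (omap f y).
Proof. exact: cdescE. Qed.
Fact cok_ind_cgamma q : omap f (cgamma V q) = cgamma W (cok_ind q).
Proof.
by have [y ->] := cproj_surj q; rewrite cok_indE !cgammaE omap_mupi.
Qed.
Definition cok_map : rhom (cok_obj V) (cok_obj W) :=
  replace_map cok_indE cok_ind_cgamma.
End Morphism.

Fact cok_map1 (V : pirep lam) : cok_map (rid V) = rid (cok_obj V).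
Proof.
apply: rhom_ext => j x; apply: replace_map_at_id => q.
have [y ->] := cproj_surj q; rewrite [LHS]cok_indE; congr (cproj _ _).
by apply: dsumP => a; rewrite omapE.
Qed.

Fact cok_mapM (U V W : pirep lam) (g : rhom V W) (f : rhom U V) :
  cok_map (rcomp g f) = rcomp (cok_map g) (cok_map f).
Proof.
apply: rhom_ext => j x; apply: replace_map_at_comp => q.
have [y ->] := cproj_surj q.
rewrite (cok_indE (rcomp g f)) (cok_indE f) (cok_indE g).
by congr (cproj _ _); apply: dsumP => a; rewrite !omapE.
Qed.

Definition cok_refl : functor (ModPi lam) (ModPi (wrefl i lam)) :=
  @Functor (ModPi lam) (ModPi (wrefl i lam)) cok_obj cok_map cok_map1 cok_mapM.

End CokernelFunctor.

Section KernelFunctor.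
Variable lam : {ffun Q -> K}.
Hypothesis li : loopfree i.

Section Object.
Variable V : pirep lam.
Fact kgamma_subproof y : pi V (mupi V lam y) = 0.
Proof. exact/pi_mupi/pirepP. Qed.
(* The map gamma', characterised by iota gamma' = mu pi - lam_i id. *)
Definition kgamma : {linear oplus V -> ker (pi V)} := klift kgamma_subproof.
Fact kgammaE y : kincl (pi V) (kgamma y) = mupi V lam y.
Proof. exact: kliftE. Qed.
Fact kgamma_kincl n : kgamma (kincl (pi V) n) = - lam i *: n.
Proof.
apply: (@kincl_inj _ _ _ (pi V)); rewrite kgammaE mupiE kinclP linear0 sub0r.
by rewrite [RHS]linearZZ scaleNr.
Qed.
Definition ker_obj : pirep (wrefl i lam) :=
  replace_pirep li (@pirepP _ V) kgammaE kgamma_kincl.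
End Object.

Section Morphism.
Variables (V W : pirep lam) (f : rhom V W).
Definition ker_ind_fun (n : ker (pi V)) : oplus W := omap f (kincl (pi V) n).
Fact ker_ind_linear : linear ker_ind_fun.
Proof. by move=> c x y; rewrite /ker_ind_fun !linearP. Qed.
Fact ker_ind_subproof n : pi W (lin ker_ind_linear n) = 0.
Proof.
by rewrite -[LHS]/(pi W (omap f (kincl (pi V) n))) pi_omap kinclP linear0.
Qed.
Definition ker_ind : {linear ker (pi V) -> ker (pi W)} :=
  klift ker_ind_subproof.
Fact ker_indE n : kincl (pi W) (ker_ind n) = omap f (kincl (pi V) n).
Proof. exact: kliftE. Qed.
Fact ker_ind_kgamma y : ker_ind (kgamma V y) = kgamma W (omap f y).
Proof.
by apply: (@kincl_inj _ _ _ (pi W)); rewrite ker_indE !kgammaE omap_mupi.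
Qed.
Definition ker_map : rhom (ker_obj V) (ker_obj W) :=
  replace_map ker_ind_kgamma (fun n => esym (ker_indE n)).
End Morphism.

Fact ker_map1 (V : pirep lam) : ker_map (rid V) = rid (ker_obj V).
Proof.
apply: rhom_ext => j x; apply: replace_map_at_id => n.
apply: (@kincl_inj _ _ _ (pi V)); rewrite [LHS]ker_indE.
by apply: dsumP => a; rewrite omapE.
Qed.

Fact ker_mapM (U V W : pirep lam) (g : rhom V W) (f : rhom U V) :
  ker_map (rcomp g f) = rcomp (ker_map g) (ker_map f).
Proof.
apply: rhom_ext => j x; apply: replace_map_at_comp => n.
apply: (@kincl_inj _ _ _ (pi W)).
rewrite (ker_indE (rcomp g f)) (ker_indE g) (ker_indE f).
by apply: dsumP => a; rewrite !omapE.
Qed.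

Definition ker_refl : functor (ModPi lam) (ModPi (wrefl i lam)) :=
  @Functor (ModPi lam) (ModPi (wrefl i lam)) ker_obj ker_map ker_map1 ker_mapM.

End KernelFunctor.

End Preprojective.

Arguments cok_refl {K Q i} lam li.
Arguments ker_refl {K Q i} lam li.

Section Braid.
Variables (K : fieldType) (Q : quiver) (i j : Q).

Lemma card_arrows_between : i != j ->
  #|arrows_between i j| = #|@arr (double Q) i j|.
Proof.
move=> ij; rewrite card_double_arr !card_sig.
set P := [pred a : arrow Q | _]; set R := [pred a : arrow Q | _].
have PR0 : #|[predI P & R]| = 0%N.
  apply: eq_card0 => a; rewrite !inE; apply/negP => /andP[/andP[/eqP ti _]].
  by case/andP => /eqP tj _; move: ij; rewrite -ti tj eqxx.
rewrite -cardUI PR0 addn0; apply: eq_card => a.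
by rewrite !inE.
Qed.

Local Notation cc k l := ((symform (coord k) (coord l))%:~R : K).

Lemma wreflE (k l : Q) (lam : {ffun Q -> K}) :
  wrefl k lam l = lam l - cc k l * lam k.
Proof. exact: ffunE. Qed.

Lemma symform_loopfree (k : Q) : loopfree k -> cc k k = 2.
Proof. by move=> lk; rewrite symform_coord eqxx card_loopfree // subr0. Qed.

Lemma symform_neq : i != j -> cc i j = - #|arrows_between i j|%:R.
Proof.
move=> ij; rewrite symform_coord card_arrows_between // (negbTE ij) mul0rn.
by rewrite sub0r mulrNz natz.
Qed.

Lemma symformC (k l : Q) : cc k l = cc l k.
Proof. by rewrite /symform addrC. Qed.

Lemma wrefl_comm (lam : {ffun Q -> K}) : #|arrows_between i j| = 0%N ->
  wrefl i (wrefl j lam) = wrefl j (wrefl i lam).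
Proof.
have [<- //|ij n0] := eqVneq i j.
have cij := symform_neq ij; have cji := symformC j i; rewrite cij n0 in cji.
apply/ffunP => k; rewrite !wreflE cij cji n0; ring.
Qed.

Hypotheses (li : loopfree i) (lj : loopfree j).

Lemma wrefl_braid (lam : {ffun Q -> K}) : #|arrows_between i j| = 1%N ->
  wrefl i (wrefl j (wrefl i lam)) = wrefl j (wrefl i (wrefl j lam)).
Proof.
have [<- //|ij n1] := eqVneq i j.
have cij := symform_neq ij; have cji := symformC j i; rewrite cij n1 in cji.
have cii := symform_loopfree li; have cjj := symform_loopfree lj.
apply/ffunP => k; rewrite !wreflE cij cji cii cjj n1; ring.
Qed.

End Braid.

Arguments wrefl_comm {K Q i j} lam.
Arguments wrefl_braid {K Q i j} li lj lam.

(* Main.v *)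
Require Import Defs.
From mathcomp Require Import all_boot all_order all_algebra.
Import Defs.
From mathcomp Require Import boolp ring.

(** Let I = {i, j} and let X be one of the composites applied to V. At vertices
    outside I nothing has changed, and a path of arrows of X of length at most
    three whose two ends lie outside I acts as in V, up to a multiple of the
    identity that is the same for both composites.

    For the cokernel functors, X is generated by the spaces outside I: for
    v in I, with w the other element of I, X_v is the cokernel of
      V_w -> R + S
    where R (resp. S) is the sum of V_(tail a) over the arrows a with head v
    (resp. w) and tail outside I; R maps to X_v by the arrows a themselves, and
    S by the paths through w. When no arrow joins i and j, X_v is simply the
    cokernel of V_v -> R. This description is symmetric in i and j, hence both
    composites have the same presentation outside I, and the partially defined
    identity extends to an isomorphism. Naturality holds because morphisms are
    determined outside I. Kernel functors are treated dually, with X_v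
    cogenerated by the spaces outside I and equal to the kernel of
    R + S -> V_w. *)

Set Implicit Arguments.
Unset Strict Implicit.
Unset Printing Implicit Defensive.

Import GRing.Theory.
Local Open Scope ring_scope.

Section LinearRelations.
Variables (K : fieldType) (Q : quiver).
Local Notation rep := (rep K (double Q)).

(** * Linear relations between representations *)

(* The isomorphisms are built as relations: at a vertex [v] the two sides only
   have a common presentation, so no formula for the map is at hand. *)
Record linrel (X Y : rep) (rho : forall v, X v -> Y v -> Prop) : Prop := {
  linrelP : forall v c (x1 x2 : X v) (y1 y2 : Y v),
    rho v x1 y1 -> rho v x2 y2 -> rho v (c *: x1 + x2) (c *: y1 + y2);
  linrel_arr : forall k l (a : darr k l) (x : X k) (y : Y k),
    rho k x y -> rho l (rmap X a x) (rmap Y a y);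
  linrel_total : forall v (x : X v), exists y, rho v x y;
  linrel_fun0 : forall v (y : Y v), rho v 0 y -> y = 0 }.

Lemma linrel_iff (X Y : rep) (rho rho' : forall v, X v -> Y v -> Prop) :
  (forall v x y, rho v x y <-> rho' v x y) -> linrel rho -> linrel rho'.
Proof.
move=> e [lin arr tot fun0]; split=> [v c x1 x2 y1 y2|k l a x y|v x|v y].
- by rewrite -!e; apply: lin.
- by rewrite -!e; apply: arr.
- by have [y r] := tot v x; exists y; rewrite -e.
- by rewrite -e; apply: fun0.
Qed.

(** By linearity the difference of two values is a value at 0. *)
Lemma linrel_fun (X Y : rep) (rho : forall v, X v -> Y v -> Prop) :
  linrel rho -> forall v x y z, rho v x y -> rho v x z -> y = z.
Proof.
move=> R v x y z xy xz; apply/eqP; rewrite -subr_eq0; apply/eqP.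
apply: (linrel_fun0 R); have := linrelP R (-1) xz xy.
by rewrite !scaleN1r addNr addrC.
Qed.

(** Single-valuedness forces any choice of values to be linear and to commute with the arrows. *)
Lemma linrel_hom (X Y : rep) (rho : forall v, X v -> Y v -> Prop) :
  linrel rho -> exists f : rhom X Y, forall v x, rho v x (f v x).
Proof.
move=> R; pose F v x := projT1 (cid (linrel_total R x)) : Y v.
have FP v x : rho v x (F v x) by rewrite /F; case: cid.
have Flin v : linear (F v).
  by move=> c x y; apply: (linrel_fun R (FP _ _)); apply: (linrelP R).
have Farr k l (a : darr k l) x : F l (rmap X a x) = rmap Y a (F k x).
  by apply: (linrel_fun R (FP _ _)); apply: (linrel_arr R).
by exists (@RHom K (double Q) X Y (fun v => lin (Flin v)) Farr).
Qed.

(** The relation and its converse give morphisms in both directions. They are mutually inverse and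
    natural because each equation compares two values related to the same element. *)
Lemma functor_iso_linrel (C : category) (mu : {ffun Q -> K})
    (F G : functor C (ModPi mu))
    (rho : forall (V : C) v, (F V : pirep mu) v -> (G V : pirep mu) v -> Prop) :
  (forall V, linrel (rho V)) -> (forall V, linrel (fun v x y => rho V v y x)) ->
  (forall (V W : C) (f : chom V W) v x y, rho V v x y ->
     rho W v ((fmap F f : rhom _ _) v x) ((fmap G f : rhom _ _) v y)) ->
  functor_iso F G.
Proof.
move=> R R' nat; pose eta V := projT1 (cid (linrel_hom (R V))).
have etaP V v x : rho V v x (eta V v x) by rewrite /eta; case: cid.
exists eta; split=> [V|V W f].
  have [g gP] := linrel_hom (R' V); exists g.
  split; apply: rhom_ext => v x.
    exact: (linrel_fun (R' V) (gP _ _) (etaP _ _ _)).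
  exact: (linrel_fun (R V) (etaP _ _ _) (gP _ _)).
apply: rhom_ext => v x; apply: (linrel_fun (R W) (etaP _ _ _)).
exact: nat.
Qed.

End LinearRelations.

(** * One reflection *)

Section FamilyMaps.
Variables (K : fieldType) (Q : quiver).
Local Notation rep := (rep K (double Q)).
Implicit Types (V W : rep) (i k l : Q).

Section Omapf.
Variables (V W : rep) (e : forall k, {linear V k -> W k}) (i : Q).
(** A version of [omap] for families that need not commute with the arrows, such as the
    identification of a representation with its reflection outside [i]. *)
Definition omapf_fun (y : oplus i V) : oplus i W := [ffun a => e (tag a) (y a)].
Lemma omapf_funE y a : omapf_fun y a = e (tag a) (y a).
Proof. exact: ffunE. Qed.
Fact omapf_linear : linear omapf_fun.
Proof.
move=> c x y; apply: dsumP => a; rewrite dsumDE dsumZE !omapf_funE.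
by rewrite dsumDE dsumZE linearP.
Qed.
Definition omapf : {linear oplus i V -> oplus i W} := lin omapf_linear.
Lemma omapfE y a : omapf y a = e (tag a) (y a).
Proof. exact: ffunE. Qed.
Lemma omapf_dinj a x : omapf (dinj a x) = dinj a (e (tag a) x).
Proof.
apply: dsumP => b; rewrite omapfE.
have [<-|ab] := eqVneq a b; first by rewrite !dinj_eq.
by rewrite !dinj_neq // linear0.
Qed.
End Omapf.

(* The identity of [V k] when [a] is the reverse of [a'], and 0 otherwise. *)
Definition delta V k i l (a' : darr k i) (a : darr i l) (x : V k) : V l :=
  (dinj (to_into a') x : oplus i V) (to_into (star a)).

(** [delta] is an injection into the direct sum followed by a projection, and [omapf] commutes with
    both. *)
Lemma delta_map V W (e : forall k, {linear V k -> W k}) k i l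
    (a' : darr k i) (a : darr i l) x :
  e l (delta a' a x) = delta a' a (e k x).
Proof.
rewrite /delta -[LHS](omapfE e (dinj (to_into a') x) (to_into (star a))).
by rewrite omapf_dinj.
Qed.

Lemma delta_neq V k i l (a' : darr k i) (a : darr i l) (x : V k) :
  k != l -> delta a' a x = 0.
Proof.
move=> kl; rewrite /delta dinj_neq //; apply: contraNneq kl => e; apply/eqP.
exact: (congr1 (fun u : into i => tag u) e).
Qed.

End FamilyMaps.

Section Keep.
Variables (K : fieldType) (Q : quiver) (i : Q) (V : rep K (double Q)).
Variable N : lmodType K.

Section At.
Variables (k : Q) (b : bool) (r : reflect (i = k) b).

(* The identity outside [i], made total by 0 at [i]; [back_at] is likewise a
   total inverse. Sums over all arrows thus ignore those with tail [i]. *)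
Definition keep_at_fun (x : V k) : rsp_at V N r :=
  match r return rsp_at V N r with ReflectT _ => 0 | ReflectF _ => x end.
Fact keep_at_linear : linear keep_at_fun.
Proof.
by rewrite /keep_at_fun; case: r => [e|ne] c x y //;
  rewrite scaler0 addr0.
Qed.
Definition keep_at : {linear V k -> rsp_at V N r} := lin keep_at_linear.

Definition back_at_fun (x : rsp_at V N r) : V k :=
  match r return rsp_at V N r -> V k with
  | ReflectT _ => fun=> 0
  | ReflectF _ => fun x => x
  end x.
Fact back_at_linear : linear back_at_fun.
Proof.
by rewrite /back_at_fun; case: r => [e|ne] c x y //;
  rewrite scaler0 addr0.
Qed.
Definition back_at : {linear rsp_at V N r -> V k} := lin back_at_linear.

Definition new_at_fun (n : N) : rsp_at V N r :=
  match r return rsp_at V N r with ReflectT _ => n | ReflectF _ => 0 end.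
Fact new_at_linear : linear new_at_fun.
Proof.
by rewrite /new_at_fun; case: r => [e|ne] c x y //;
  rewrite scaler0 addr0.
Qed.
Definition new_at : {linear N -> rsp_at V N r} := lin new_at_linear.

Lemma keep_atK : i != k -> cancel keep_at back_at.
Proof.
move=> ik x; rewrite !linE /keep_at_fun /back_at_fun.
by case: r => // e; case/eqP: ik.
Qed.

Lemma back_atK : i != k -> cancel back_at keep_at.
Proof.
move=> ik x; rewrite !linE /keep_at_fun /back_at_fun.
by case: r x => // e; case/eqP: ik.
Qed.
End At.

Lemma keep_at_new b (r : reflect (i = i) b) x : keep_at r x = 0.
Proof. by rewrite linE /keep_at_fun; case: r. Qed.

Lemma back_at_new b (r : reflect (i = i) b) x : back_at r x = 0.
Proof. by rewrite linE /back_at_fun; case: r x. Qed.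

Lemma new_at_surj b (r : reflect (i = i) b) x : exists n, x = new_at r n.
Proof. by case: r x => [e|ne] x; [exists x | case: (ne erefl)]. Qed.

Lemma new_at_inj b (r : reflect (i = i) b) : injective (new_at r).
Proof. by case: r => [e|ne] x y; last case: (ne erefl). Qed.

Variables (p : {linear oplus i V -> N}) (s : {linear N -> oplus i V}).

Lemma rmap_at_keep k l (a : darr k l) bk (rk : reflect (i = k) bk)
    bl (rl : reflect (i = l) bl) x : i != k -> i != l ->
  rmap_at p s a rk rl (keep_at rk x) = keep_at rl (rmap V a x).
Proof.
move=> /eqP ik /eqP il; case: rk => [e|nk]; first by case: (ik e).
by case: rl => [e|nl]; first by case: (il e).
Qed.

Lemma rmap_at_in k (a : darr k i) bk (rk : reflect (i = k) bk)
    b (r : reflect (i = i) b) x : i != k ->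
  rmap_at p s a rk r (keep_at rk x) =
    new_at r (eps K a *: p (dinj (to_into a) x)).
Proof.
move=> /eqP ik; case: rk => [e|nk]; first by case: (ik e).
case: r => [e|ne]; last by case: (ne erefl).
(* Equality proofs between vertices are unique, so the cast in [rmap_at] disappears. *)
by rewrite (eq_irrelevance e erefl).
Qed.

Lemma rmap_at_out l (a : darr i l) bl (rl : reflect (i = l) bl)
    b (r : reflect (i = i) b) n : i != l ->
  rmap_at p s a r rl (new_at r n) = keep_at rl (s n (to_into (star a))).
Proof.
move=> /eqP il; case: rl => [e|nl]; first by case: (il e).
case: r => [e|ne]; last by case: (ne erefl).
by rewrite (eq_irrelevance e erefl).
Qed.

Hypothesis li : loopfree i.
Local Notation X := (replace p s).

Definition keep (k : Q) : {linear V k -> X k} := keep_at (i =P k).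
Definition back (k : Q) : {linear X k -> V k} := back_at (i =P k).
Definition new : {linear N -> X i} := new_at (i =P i).

Lemma loopfree_neq k (a : darr k i) : i != k.
Proof.
apply/eqP => e; case: k / e a => a.
by have /card0_eq/(_ a) := card_loopfree li.
Qed.

(** The sign put on the arrows with head [i] in [replace] cancels the sign in [pi]. Together with
    [mu_new], this lets the universal properties of cokernel and kernel be read from [pi] and [mu]
    of the new representation. *)
Lemma pi_keep y : pi i X (omapf keep i y) = new (p y).
Proof.
rewrite piE [in RHS](dsum_decomp y) !linear_sum.
apply: eq_bigr => -[k a] _; rewrite omapfE.
rewrite -[rmap _ _ _]/(rmap_at p s a (i =P k) (i =P i) (keep_at (i =P k) _)).
rewrite rmap_at_in; last exact: loopfree_neq a.
by rewrite [X in _ *: X = _]linearZ scalerA eps_sq scale1r.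
Qed.

Lemma mu_new n : mu i X (new n) = omapf keep i (s n).
Proof.
apply: dsumP => -[k a]; rewrite muE omapfE [LHS]/= rmap_at_out ?starK //.
exact: loopfree_neq a.
Qed.

End Keep.

Section OneStep.
Variables (K : fieldType) (Q : quiver).
Local Notation rep := (rep K (double Q)).
Local Notation family V W := (forall k : Q, {linear V k -> W k}).

(* [step i c e h] records that X is a reflection of V at [i] with parameter
   [c]; the last field is the equation gamma c = mu pi - lam_i id read between
   two components of the direct sum. *)
Record step (i : Q) (li : K) (V X : rep)
    (e : family V X) (h : family X V) : Prop := {
  step_e0 : forall x, e i x = 0;
  step_h0 : forall x, h i x = 0;
  step_eK : forall k, i != k -> cancel (e k) (h k);
  step_hK : forall k, i != k -> cancel (h k) (e k);
  step1 : forall k l (a : darr k l) x, i != k -> i != l ->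
    rmap X a (e k x) = e l (rmap V a x);
  step2 : forall k l (a' : darr k i) (a : darr i l) x,
    rmap X a (rmap X a' (e k x)) =
      e l (rmap V a (rmap V a' x) - (eps K a' * li) *: delta a' a x) }.

(** Exactness of V_i -> V_oplus -> X_i -> 0, where [e] identifies the direct sums at [i] of V and X.
    The space X_i is thus described without naming a quotient. *)
Definition cok_exact (i : Q) (V X : rep) (e : family V X) :=
  (forall x, exists y, x = pi i X (omapf e i y)) /\
  (forall y, pi i X (omapf e i y) = 0 <-> exists x, y = mu i V x).

(** Dually, exactness of 0 -> X_i -> V_oplus -> V_i. *)
Definition ker_exact (i : Q) (V X : rep) (e : family V X) :=
  (forall x, mu i X x = 0 -> x = 0) /\
  (forall y, pi i V y = 0 <-> exists x, omapf e i y = mu i X x).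

Section Replace.
Variables (i : Q) (li : loopfree i) (lam : {ffun Q -> K}) (V : rep).
Variables (N : lmodType K) (p : {linear oplus i V -> N}).
Variable s : {linear N -> oplus i V}.

(** A path of two arrows through [i] is, up to sign, a component of [s] after [p], that is of mu pi
    - lam_i id. Cokernels and kernels are thus covered at once. *)
Lemma step_replace : (forall y, s (p y) = mupi i V lam y) ->
  step i (lam i) (keep p s) (back p s).
Proof.
move=> sp; split=> [x|x|k ik|k ik|k l a x ik il|k l a' a x].
- exact: keep_at_new.
- exact: back_at_new.
- exact: keep_atK.
- exact: back_atK.
- exact: rmap_at_keep.
have ik := loopfree_neq li a'; have il := loopfree_neq li (star a).
rewrite -[LHS]/(rmap_at p s a (i =P i) (i =P l)
  (rmap_at p s a' (i =P k) (i =P i) (keep_at V N (i =P k) x))).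
rewrite rmap_at_in // rmap_at_out //; apply: (congr1 (keep_at V N (i =P l))).
rewrite linearZ dsumZE sp mupiE pi_dinj dsumDE dsumNE dsumZE.
rewrite linearZ dsumZE muE /= starK scalerBr !scalerA eps_sq scale1r.
by [].
Qed.

End Replace.

Lemma cok_stepP (i : Q) (li : loopfree i) (lam : {ffun Q -> K})
    (V : pirep lam) : cok_exact i (keep (cproj (mu i V)) (cgamma i V)).
Proof.
split=> [x|y].
  have [n ->] := new_at_surj x; have [y ->] := cproj_surj n.
  by exists y; rewrite pi_keep.
rewrite pi_keep // -[X in _ = X](linear0 (new _ _)).
split=> [/new_at_inj/eqP|[x ->]]; last by rewrite cprojP.
rewrite -(linear0 (cproj _)) => /eqP/cproj_fun_eq/im_predP[x].
by rewrite subr0; exists x.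
Qed.

Lemma ker_stepP (i : Q) (li : loopfree i) (lam : {ffun Q -> K})
    (V : pirep lam) : ker_exact i (keep (kgamma i V) (kincl (pi i V))).
Proof.
(* [keep] is injective away from [i], and no arrow with head [i] starts at [i]. *)
have kinj y z : omapf (keep (kgamma i V) (kincl (pi i V))) i y =
    omapf (keep (kgamma i V) (kincl (pi i V))) i z -> y = z.
  move=> yz; apply: dsumP => -[k a]; have ik := loopfree_neq li a.
  have /(congr1 (fun u : oplus i _ => u (to_into a))) := yz.
  by rewrite !omapfE => /(can_inj (keep_atK _ _ ik)).
split=> [x|y].
  have [n ->] := new_at_surj x; rewrite mu_new // => e.
  suff -> : n = 0 by rewrite linear0.
  by apply: (@kincl_inj _ _ _ (pi i V)); apply: kinj; rewrite e !linear0.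
split=> [y0|[x]]; last first.
  by have [n ->] := new_at_surj x; rewrite mu_new // => /kinj ->; rewrite kinclP.
have yk : y \in ker_pred (pi i V) by rewrite unfold_in y0.
by exists (new (kgamma i V) (kincl (pi i V)) (Ker yk)); rewrite mu_new.
Qed.

End OneStep.

(** * Representations determined outside a set of vertices *)

Section Framed.
Variables (K : fieldType) (Q : quiver).
Local Notation rep := (rep K (double Q)).
Local Notation family V W := (forall k : Q, {linear V k -> W k}).
Implicit Types (u v w k l : Q) (X Y : rep).

(** [nu v] is the total parameter of the reflections made at [v]. No [delta] occurs in [frame3]: the
    reverse of [b] ends outside [I] and the reverse of [a] starts outside [I], so neither is
    [a']. *)
Record frame (I : {set Q}) (nu : Q -> K) (V X : rep) (g : family V X)
    (h : family X V) : Prop := {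
  frame_g0 : forall k x, k \in I -> g k x = 0;
  frame_h0 : forall k x, k \in I -> h k x = 0;
  frame_gK : forall k, k \notin I -> cancel (g k) (h k);
  frame_hK : forall k, k \notin I -> cancel (h k) (g k);
  frame1 : forall k l (a : darr k l) x, k \notin I -> l \notin I ->
    rmap X a (g k x) = g l (rmap V a x);
  frame2 : forall v k l (a' : darr k v) (a : darr v l) x,
    v \in I -> k \notin I -> l \notin I ->
    rmap X a (rmap X a' (g k x)) =
      g l (rmap V a (rmap V a' x) - (eps K a' * nu v) *: delta a' a x);
  frame3 : forall u v k l (b : darr k u) (a' : darr u v) (a : darr v l) x,
    u \in I -> v \in I -> k \notin I -> l \notin I ->
    rmap X a (rmap X a' (rmap X b (g k x))) =
      g l (rmap V a (rmap V a' (rmap V b x))) }.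

(** One condition for both cases of the theorem: for two loop-free vertices it is vacuous when no
    arrow joins them, and holds when exactly one does. *)
Definition inner_unique (I : {set Q}) :=
  forall v (c c' : into v), v \in I -> tag c \in I -> tag c' \in I -> c = c'.

(** The preprojective relation at [l] has a single term through [I]. Solving for it trades the path
    from [l] to [k] and back for a scalar and paths through vertices outside [I]. *)
Lemma preproj_inner (I : {set Q}) (mu : {ffun Q -> K}) (X : rep) k l
    (a : darr k l) (z : X l) : preproj mu X -> inner_unique I ->
  k \in I -> l \in I ->
  eps K a *: rmap X a (rmap X (star a) z) =
    mu l *: z - \sum_(c : into l | tag c \notin I)
      eps K (tagged c) *: rmap X (tagged c) (rmap X (star (tagged c)) z).
Proof.
move=> XP iu kI lI; rewrite -XP (bigID (fun c : into l => tag c \in I)) /= addrK.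
rewrite (big_pred1 (to_into a)) // => c /=.
by apply/idP/eqP => [cI|->] //; apply: (iu l).
Qed.

(** * The relation given by common generators *)

Section CokernelRelation.
Variables (I : {set Q}) (nu : Q -> K) (mu : {ffun Q -> K}) (V : rep).
Hypothesis iu : inner_unique I.

(* The map R + S -> X_v of the header, with [s w] the component of S at w; the
   components of [r] and [s] with tail in [I] are killed by [g]. *)
Definition gen (X : rep) (g : family V X) v (r : oplus v V)
    (s : forall w, oplus w V) : X v :=
  pi v X (omapf g v r) + \sum_(a : into v | tag a \in I)
    eps K (tagged a) *:
      rmap X (tagged a) (pi (tag a) X (omapf g (tag a) (s (tag a)))).

Lemma genP X (g : family V X) v c r1 r2 (s1 s2 : forall w, oplus w V) :
  gen g (c *: r1 + r2 : oplus v V) (fun w => c *: s1 w + s2 w) =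
    c *: gen g r1 s1 + gen g r2 s2.
Proof.
rewrite /gen !linearP scalerDr addrACA; congr (_ + _).
rewrite [X in _ = X + _]scaler_sumr -big_split.
apply: eq_bigr => a _.
rewrite (linearP (omapf g _)) (linearP (pi _ X)) (linearP (rmap X _)).
by rewrite scalerDr !scalerA mulrC.
Qed.

Lemma gen0 X (g : family V X) v : gen g (0 : oplus v V) (fun=> 0) = 0.
Proof. by rewrite /gen !linear0 big1 ?addr0 // => a _; rewrite !linear0. Qed.

Lemma gen_in X (g : family V X) k v (a : darr k v) m :
  gen g (eps K a *: dinj (to_into a) m : oplus v V) (fun=> 0) =
    rmap X a (g k m).
Proof.
rewrite /gen big1 => [|b _]; last by rewrite !linear0.
by rewrite addr0 !linearZZ omapf_dinj pi_dinj scalerA eps_sq scale1r.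
Qed.

(** An inner arrow carries the R part at [k] to the S part at [v]; [inner_unique] leaves a single
    summand there. *)
Lemma gen_inner X (g : family V X) k v (a : darr k v) (r : oplus k V) :
  k \in I -> v \in I ->
  gen g (0 : oplus v V) (dfwith (fun=> 0) (eps K a *: r)) =
    rmap X a (pi k X (omapf g k r)).
Proof.
move=> kI vI; rewrite /gen !linear0 add0r (big_pred1 (to_into a)) => [|c /=].
  rewrite -[LHS]/(eps K a *: rmap X a (pi k X (omapf g k
    (dfwith (fun w => 0 : oplus w V) (eps K a *: r) k)))).
  by rewrite dfwith_in !linearZZ scalerA eps_sq scale1r.
by apply/idP/eqP => [cI|->] //; apply: (iu vI).
Qed.

(** The graph of the sought isomorphism: related elements have a common presentation by elements of
    V. That it is a graph depends on the kernels of the two presentations. *)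
Definition crel (X Y : rep) (g : family V X) (g' : family V Y) v
    (x : X v) (y : Y v) : Prop :=
  (v \notin I -> exists m, x = g v m /\ y = g' v m) /\
  (v \in I -> exists r s, x = gen g r s /\ y = gen g' r s).

Section Closure.
Variables (X Y : rep) (g : family V X) (g' : family V Y).
Variables (h : family X V) (h' : family Y V).
Hypotheses (Xf : frame I nu g h) (Yf : frame I nu g' h').
Hypotheses (XP : preproj mu X) (YP : preproj mu Y).
Local Notation crel := (crel g g').

Lemma crelP v c x1 x2 y1 y2 :
  crel x1 y1 -> crel x2 y2 ->
  crel (c *: x1 + x2 : X v) (c *: y1 + y2).
Proof.
move=> [o1 i1] [o2 i2]; split=> vI.
  have [m1 [-> ->]] := o1 vI; have [m2 [-> ->]] := o2 vI.
  by exists (c *: m1 + m2); rewrite !linearP.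
have [r1 [s1 [-> ->]]] := i1 vI; have [r2 [s2 [-> ->]]] := i2 vI.
by exists (c *: r1 + r2), (fun w => c *: s1 w + s2 w); rewrite !genP.
Qed.

Lemma crelD v x1 x2 y1 y2 :
  crel x1 y1 -> crel x2 y2 -> crel (x1 + x2 : X v) (y1 + y2).
Proof. by move=> xy1 xy2; rewrite -[x1]scale1r -[y1]scale1r; apply: crelP. Qed.

Lemma crel_g k m : crel (g k m) (g' k m).
Proof.
split=> kI; first by exists m.
exists 0, (fun=> 0); rewrite (frame_g0 Xf) // (frame_g0 Yf) //.
by rewrite !gen0.
Qed.

Lemma crel0 v : crel (0 : X v) (0 : Y v).
Proof. by rewrite -(linear0 (g v)) -(linear0 (g' v)); apply: crel_g. Qed.

Lemma crelZ v c x y : crel x y -> crel (c *: x : X v) (c *: y).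
Proof.
move=> xy; rewrite -[_ *: x]addr0 -[_ *: y]addr0; apply: crelP => //.
exact: crel0.
Qed.

Lemma crelN v x y : crel x y -> crel (- x : X v) (- y).
Proof. by rewrite -scaleN1r -[- y]scaleN1r; apply: crelZ. Qed.

Lemma crel_sum (J : finType) (P : pred J) v (F : J -> X v) (F' : J -> Y v) :
  (forall j, P j -> crel (F j) (F' j)) ->
  crel (\sum_(j | P j) F j) (\sum_(j | P j) F' j).
Proof.
move=> FF; elim/big_rec2: _ => [|j x y Pj xy]; first exact: crel0.
by apply: crelD => //; apply: FF.
Qed.

Lemma crel_arr_g k l (a : darr k l) m :
  crel (rmap X a (g k m)) (rmap Y a (g' k m)).
Proof.
have [kI|kI] := boolP (k \in I).
  by rewrite (frame_g0 Xf) // (frame_g0 Yf) // !linear0; apply: crel0.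
have [lI|lI] := boolP (l \in I); last first.
  by rewrite (frame1 Xf) // (frame1 Yf) //; apply: crel_g.
split=> [|_]; first by rewrite lI.
by exists (eps K a *: dinj (to_into a) m), (fun=> 0); rewrite !gen_in.
Qed.

Lemma crel_pi v r : crel (pi v X (omapf g v r)) (pi v Y (omapf g' v r)).
Proof.
rewrite !piE; apply: crel_sum => a _; apply: crelZ.
by rewrite !omapfE; apply: crel_arr_g.
Qed.

(** Followed by an arrow out of [I], a generator becomes a combination of paths of length at most
    three with both ends outside [I], and there the two frames agree. *)
Lemma crel_arr_out k l (a : darr k l) x y : l \notin I ->
  crel x y -> crel (rmap X a x) (rmap Y a y).
Proof.
move=> lI [xo xi]; have [kI|kI] := boolP (k \in I); last first.
  by have [m [-> ->]] := xo kI; apply: crel_arr_g.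
have two j (b : darr j k) m :
    crel (rmap X a (rmap X b (g j m))) (rmap Y a (rmap Y b (g' j m))).
  have [jI|jI] := boolP (j \in I).
    by rewrite (frame_g0 Xf) // (frame_g0 Yf) // !linear0; apply: crel0.
  by rewrite (frame2 Xf) // (frame2 Yf) //; apply: crel_g.
have [r [s [-> ->]]] := xi kI; rewrite /gen.
rewrite !linearD; apply: crelD.
  rewrite !piE !linear_sum; apply: crel_sum => b _; rewrite !linearZZ !omapfE.
  exact/crelZ/two.
rewrite !linear_sum; apply: crel_sum => b bI; rewrite !linearZZ; apply: crelZ.
rewrite !piE !linear_sum; apply: crel_sum => c _; rewrite !linearZZ; apply: crelZ.
rewrite !omapfE; have [cI|cI] := boolP (tag c \in I).
  by rewrite (frame_g0 Xf) // (frame_g0 Yf) // !linear0; apply: crel0.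
by rewrite (frame3 Xf) // (frame3 Yf) //; apply: crel_g.
Qed.

Lemma crel_arr_in k l (a : darr k l) x y : k \notin I ->
  crel x y -> crel (rmap X a x) (rmap Y a y).
Proof. by move=> kI [/(_ kI)[m [-> ->]] _]; apply: crel_arr_g. Qed.

Lemma crel_arr k l (a : darr k l) x y :
  crel x y -> crel (rmap X a x) (rmap Y a y).
Proof.
have [lI|lI xy] := boolP (l \in I); last exact: crel_arr_out.
have [kI|kI] := boolP (k \in I); last first.
  by case=> /(_ kI)[m [-> ->]] _; apply: crel_arr_g.
case=> _ /(_ kI)[r [s [-> ->]]]; rewrite /gen.
rewrite !linearD; apply: crelD.
  split=> [|_]; first by rewrite lI.
  exists 0, (dfwith (fun w => 0 : oplus w V) (eps K a *: r : oplus k V)).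
  by rewrite !gen_inner.
(* The only arrow from [I] to [k] is the reverse of [a], so what is left is the path along [star a]
   and back along [a], applied to [z]. *)
have oneE : (fun b : into k => tag b \in I) =1 pred1 (to_into (star a)).
  by move=> b; apply/idP/eqP => [bI|->] //; apply: (iu kI).
rewrite !(big_pred1 _ oneE).
set z := pi l X (omapf g l (s l)); set z' := pi l Y (omapf g' l (s l)).
rewrite -[X in crel X _]/(rmap X a (eps K (star a) *: rmap X (star a) z)).
rewrite -[X in crel _ X]/(rmap Y a (eps K (star a) *: rmap Y (star a) z')).
rewrite !linearZZ eps_star !scaleNr; apply: crelN.
(* The relation at [l] replaces this path by a multiple of [z] and by paths that leave [I] and come
   back, which are known to preserve [crel]. *)
rewrite (preproj_inner a z XP iu) // (preproj_inner a z' YP iu) //.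
have zz : crel z z' by apply: crel_pi.
apply: crelD; first exact: crelZ.
apply: crelN; apply: crel_sum => c cI.
by apply: crelZ; apply: crel_arr_in => //; apply: crel_arr_out.
Qed.

(** Totality is generation of X. Single-valuedness is the inclusion of kernels inside [I], and
    injectivity of [g] outside. *)
Lemma crel_linrel :
  (forall v (x : X v), v \in I -> exists r s, x = gen g r s) ->
  (forall v (r : oplus v V) s, v \in I -> gen g r s = 0 -> gen g' r s = 0) ->
  linrel (fun v (x : X v) (y : Y v) => crel x y).
Proof.
move=> Xgen ker; split=> [v c x1 x2 y1 y2|k l a x y|v x|v y [yo yi]].
- exact: crelP.
- exact: crel_arr.
- have [vI|vI] := boolP (v \in I).
    have [r [s ->]] := Xgen v x vI; exists (gen g' r s).
    by split=> [|_]; [rewrite vI | exists r, s].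
  exists (g' v (h v x)); split=> [_|]; last by rewrite (negbTE vI).
  by exists (h v x); rewrite (frame_hK Xf).
have [vI|vI] := boolP (v \in I).
  by have [r [s [/esym/ker ->]]] := yi vI.
have [m [m0 ->]] := yo vI; rewrite -(frame_gK Xf vI m) -m0.
by rewrite !linear0.
Qed.

End Closure.

Lemma crelC X Y (g : family V X) (g' : family V Y) v (x : X v) (y : Y v) :
  crel g g' x y -> crel g' g y x.
Proof.
case=> xyo xyi; split=> [/xyo[m []]|/xyi[r [s []]]]; first by exists m.
by exists r, s.
Qed.

End CokernelRelation.

(** * The relation given by common values outside the set *)

Section KernelRelation.
Variables (I : {set Q}) (nu : Q -> K) (mu : {ffun Q -> K}) (V : rep).
Hypothesis iu : inner_unique I.

(** Dual to [crel]: elements are compared through their images outside [I], along one arrow or along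
    two arrows through [I]. In a frame the conditions with [k] in [I] are void, since [h] vanishes
    there. *)
Definition krel X Y (h : family X V) (h' : family Y V) v
    (x : X v) (y : Y v) : Prop :=
  (v \notin I -> h v x = h' v y) /\
  (v \in I ->
     (forall k (a : darr v k), h k (rmap X a x) = h' k (rmap Y a y)) /\
     (forall w k (b : darr v w) (a : darr w k), w \in I ->
        h k (rmap X a (rmap X b x)) = h' k (rmap Y a (rmap Y b y)))).

Section Closure.
Variables (X Y : rep) (g : family V X) (g' : family V Y).
Variables (h : family X V) (h' : family Y V).
Hypotheses (Xf : frame I nu g h) (Yf : frame I nu g' h').
Hypotheses (XP : preproj mu X) (YP : preproj mu Y).
Local Notation krel := (krel h h').

Lemma krelP v c x1 x2 y1 y2 :
  krel x1 y1 -> krel x2 y2 ->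
  krel (c *: x1 + x2 : X v) (c *: y1 + y2).
Proof.
move=> [o1 i1] [o2 i2]; split=> vI; first by rewrite !linearP o1 // o2.
have [r1 s1] := i1 vI; have [r2 s2] := i2 vI.
by split=> [k a|w k b a wI]; rewrite !linearP ?r1 ?r2 ?s1 ?s2.
Qed.

Lemma krel0 v : krel (0 : X v) (0 : Y v).
Proof. by split=> _; [|split=> *]; rewrite !linear0. Qed.

Lemma krelD v x1 x2 y1 y2 :
  krel x1 y1 -> krel x2 y2 -> krel (x1 + x2 : X v) (y1 + y2).
Proof. by move=> xy1 xy2; rewrite -[x1]scale1r -[y1]scale1r; apply: krelP. Qed.

Lemma krelZ v c x y : krel x y -> krel (c *: x : X v) (c *: y).
Proof.
move=> xy; rewrite -[_ *: x]addr0 -[_ *: y]addr0; apply: krelP => //.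
exact: krel0.
Qed.

Lemma krelN v x y : krel x y -> krel (- x : X v) (- y).
Proof. by rewrite -scaleN1r -[- y]scaleN1r; apply: krelZ. Qed.

Lemma krel_sum (J : finType) (P : pred J) v (F : J -> X v) (F' : J -> Y v) :
  (forall j, P j -> krel (F j) (F' j)) ->
  krel (\sum_(j | P j) F j) (\sum_(j | P j) F' j).
Proof.
move=> FF; elim/big_rec2: _ => [|j x y Pj xy]; first exact: krel0.
by apply: krelD => //; apply: FF.
Qed.

(** An element outside [I] comes from V by [g]. The conditions to check at [l] then concern paths of
    length at most three between vertices outside [I]. *)
Lemma krel_arr_out k l (a : darr k l) x y : k \notin I ->
  krel x y -> krel (rmap X a x) (rmap Y a y).
Proof.
move=> kI [/(_ kI) xy _]; rewrite -(frame_hK Xf kI x) -(frame_hK Yf kI y) xy.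
have h2 j : j \in I -> forall z z', h j z = h' j z'.
  by move=> jI z z'; rewrite (frame_h0 Xf) // (frame_h0 Yf).
split=> lI.
  by rewrite (frame1 Xf) // (frame1 Yf) // (frame_gK Xf) // (frame_gK Yf).
split=> [j b|w j c b wI]; (have [jI|jI] := boolP (j \in I); first exact: h2).
  by rewrite (frame2 Xf) // (frame2 Yf) // (frame_gK Xf) // (frame_gK Yf).
by rewrite (frame3 Xf) // (frame3 Yf) // (frame_gK Xf) // (frame_gK Yf).
Qed.

Lemma krel_arr_in k l (a : darr k l) x y : k \in I -> l \notin I ->
  krel x y -> krel (rmap X a x) (rmap Y a y).
Proof.
move=> kI lI [_ /(_ kI)[xy _]]; split=> [_|]; first exact: xy.
by rewrite (negbTE lI).
Qed.

Lemma krel_arr k l (a : darr k l) x y :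
  krel x y -> krel (rmap X a x) (rmap Y a y).
Proof.
have [kI xy|kI] := boolP (k \in I); last exact: krel_arr_out.
have [lI|lI] := boolP (l \in I); last exact: krel_arr_in.
split=> [|_]; first by rewrite lI.
split=> [j b|w j b c wI]; first by case: xy => _ /(_ kI)[_]; apply.
(* The reverse of [b] and [a] are both arrows from [I] to [l]; hence [b] is the reverse of [a], and
   the path returns to [k]. *)
have e : to_into (star b) = to_into a by apply: (iu lI).
have ew : k = w := congr1 (fun u : into l => tag u) (esym e).
case: w / ew b c wI e => b c _ /eqP; rewrite eq_Tagged /= => /eqP ba.
have {ba} -> : b = star a by rewrite -ba starK.
(* The relation at [k] expresses this return path by a scalar and paths that leave [I] and come
   back. *)
have zz : krel (eps K (star a) *: rmap X (star a) (rmap X a x))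
               (eps K (star a) *: rmap Y (star a) (rmap Y a y)).
  have := preproj_inner (star a) x XP iu lI kI; rewrite starK => ->.
  have := preproj_inner (star a) y YP iu lI kI; rewrite starK => ->.
  apply: krelD; first exact: krelZ.
  apply: krelN; apply: krel_sum => d dI; apply: krelZ.
  by apply: krel_arr_out => //; apply: krel_arr_in.
have {zz} := krelZ (eps K (star a)) zz; rewrite !scalerA !eps_sq !scale1r.
by case=> _ /(_ kI)[one _]; apply: one.
Qed.

Lemma krel_linrel :
  (forall v (x : X v), v \in I -> exists y : Y v, krel x y) ->
  (forall v (y : Y v), v \in I -> krel 0 y -> y = 0) ->
  linrel (fun v (x : X v) (y : Y v) => krel x y).
Proof.
move=> tot inj; split=> [v c x1 x2 y1 y2|k l a x y|v x|v y R].
- exact: krelP.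
- exact: krel_arr.
- have [vI|vI] := boolP (v \in I); first exact: tot.
  exists (g' v (h v x)); split=> [_|]; last by rewrite (negbTE vI).
  by rewrite (frame_gK Yf).
have [vI|vI] := boolP (v \in I); first exact: inj.
by rewrite -(frame_hK Yf vI y) -R.1 // !linear0.
Qed.

End Closure.
End KernelRelation.
End Framed.

(** * Composites of reflections *)

Section Composites.
Variables (K : fieldType) (Q : quiver).
Local Notation rep := (rep K (double Q)).
Local Notation family V W := (forall k : Q, {linear V k -> W k}).
Implicit Types (u v w k l : Q).

Definition fcomp_fun (U V W : rep) (f : family V W) (g : family U V) k (x : U k) : W k :=
  f k (g k x).
Fact fcomp_linear (U V W : rep) (f : family V W) (g : family U V) k :
  linear (fcomp_fun f g (k := k)).
Proof. by move=> c x y; rewrite /fcomp_fun !linearP. Qed.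
Definition famcomp (U V W : rep) (f : family V W) (g : family U V) : family U W :=
  fun k => lin (fcomp_linear f g (k := k)).

Lemma famcompE (U V W : rep) (f : family V W) (g : family U V) k x :
  famcomp f g k x = f k (g k x).
Proof. by []. Qed.

Variables (i j : Q).
Hypotheses (ij : i != j) (loopi : loopfree i) (loopj : loopfree j).

Lemma notin_pair k : k \notin [set i; j] -> (i != k) * (j != k).
Proof. by rewrite !inE negb_or ![k == _]eq_sym => /andP[]. Qed.

Lemma no_loop u (a : darr u u) : u \notin [set i; j].
Proof.
apply/negP => /set2P[] e; move: a; rewrite e => a.
  by have := loopfree_neq loopi a; rewrite eqxx.
by have := loopfree_neq loopj a; rewrite eqxx.
Qed.

(** Each vertex of the pair is reflected once and contributes the correction of that step. The
    clause on paths of length three is vacuous, as no arrow lies inside the pair. *)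
Lemma frame_two (nu : Q -> K) (V V1 V2 : rep)
    (e1 : family V V1) (h1 : family V1 V) (e2 : family V1 V2) (h2 : family V2 V1) :
  #|darr i j| = 0%N -> step j (nu j) e1 h1 -> step i (nu i) e2 h2 ->
  frame [set i; j] nu (famcomp e2 e1) (famcomp h1 h2).
Proof.
move=> no s1 s2; have ji : j != i by rewrite eq_sym.
have noji (a : darr j i) : False by have /card0_eq/(_ (star a)) := no.
have noij (a : darr i j) : False by have /card0_eq/(_ a) := no.
split=> [k x /set2P[] e|k x /set2P[] e|k kI x|k kI x|k l a x kI lI
    |v k l a' a x /set2P[] e kI lI|u v k l b a' a x uI vI kI lI];
  rewrite ?famcompE; try have [ik jk] := notin_pair kI;
  try have [il jl] := notin_pair lI.
- by subst k; rewrite (step_e0 s2).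
- by subst k; rewrite (step_e0 s1) linear0.
- by subst k; rewrite (step_h0 s2) linear0.
- by subst k; rewrite (step_h0 s1).
- by rewrite (step_eK s2) // (step_eK s1).
- by rewrite (step_hK s1) // (step_hK s2).
- by rewrite (step1 s2) // (step1 s1).
- subst v; rewrite (step2 s2) (step1 s1) // (step1 s1) //.
  by rewrite -(delta_map e1) -linearZZ -linearB.
- subst v; rewrite (step1 s2) // (step1 s2) //.
  by rewrite (step2 s1).
case/set2P: uI => ?; case/set2P: vI => ?; subst u v.
- by have := no_loop a'; rewrite !inE eqxx.
- by case: (noij a').
- by case: (noji a').
- by have := no_loop a'; rewrite !inE eqxx orbT.
Qed.

(** Paths through [i] are corrected twice, by [l1] and by [l3], and paths through [j] once, by [l2].
    The assumption on the parameters makes the two totals equal, so that the frame does not see the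
    order of reflections. *)
Lemma frame_three (l1 l2 l3 : K) (V V1 V2 V3 : rep)
    (e1 : family V V1) (h1 : family V1 V) (e2 : family V1 V2) (h2 : family V2 V1)
    (e3 : family V2 V3) (h3 : family V3 V2) :
  step i l1 e1 h1 -> step j l2 e2 h2 -> step i l3 e3 h3 -> l1 + l3 = l2 ->
  frame [set i; j] (fun=> l2) (famcomp e3 (famcomp e2 e1))
    (famcomp h1 (famcomp h2 h3)).
Proof.
move=> s1 s2 s3 l13; have ji : j != i by rewrite eq_sym.
split=> [k x /set2P[] ?|k x /set2P[] ?|k kI x|k kI x|k l a x kI lI
    |v k l a' a x /set2P[] ? kI lI|u v k l b a' a x uI vI kI lI];
  rewrite ?famcompE; try have [ik jk] := notin_pair kI;
  try have [il jl] := notin_pair lI.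
- by subst k; rewrite (step_e0 s3).
- by subst k; rewrite (step_e0 s2) linear0.
- by subst k; rewrite (step_h0 s1).
- by subst k; rewrite (step_h0 s2) linear0.
- by rewrite (step_eK s3) // (step_eK s2) // (step_eK s1).
- by rewrite (step_hK s1) // (step_hK s2) // (step_hK s3).
- by rewrite (step1 s3) // (step1 s2) // (step1 s1).
- subst v; rewrite (step2 s3) (step1 s2) // (step1 s2) // (step2 s1).
  rewrite -(delta_map e2) -(delta_map e1) -!linearZZ -!linearB -l13.
  by rewrite mulrDr scalerDl opprD addrA.
- subst v; rewrite (step1 s3) // (step1 s3) // (step2 s2).
  rewrite (step1 s1) // (step1 s1) //.
  by rewrite -(delta_map e1) -linearZZ -linearB.
case/set2P: uI => ?; case/set2P: vI => ?; subst u v.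
- by have := no_loop a'; rewrite !inE eqxx.
(* Every correction compares an outer vertex with [i] or [j], hence is 0. *)
- rewrite (step2 s3) delta_neq 1?eq_sym // scaler0 subr0.
  rewrite (step1 s3) // (step1 s2) // (step2 s2) delta_neq // scaler0 subr0.
  by rewrite (step2 s1) delta_neq 1?eq_sym // scaler0 subr0 (step1 s1).
- rewrite (step1 s3) // (step2 s3) delta_neq // scaler0 subr0.
  rewrite (step2 s2) delta_neq 1?eq_sym // scaler0 subr0.
  by rewrite (step1 s2) // (step1 s1) // (step2 s1) delta_neq // scaler0 subr0.
- by have := no_loop a'; rewrite !inE eqxx orbT.
Qed.

End Composites.

(** * Components with tail outside the set *)

Section Outer.
Variables (K : fieldType) (Q : quiver) (I : {set Q}).
Local Notation rep := (rep K (double Q)).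
Local Notation family V W := (forall k : Q, {linear V k -> W k}).
Implicit Types (u v w k l p : Q) (X V : rep).

(* [pi] and equality restricted to the arrows with tail outside [I]. *)
Definition opi_fun v X (y : oplus v X) : X v :=
  \sum_(a : into v | tag a \notin I)
    eps K (tagged a) *: rmap X (tagged a) (y a).
Fact opi_linear v X : linear (@opi_fun v X).
Proof.
move=> c x y; rewrite /opi_fun scaler_sumr -big_split; apply: eq_bigr => a _.
by rewrite dsumDE dsumZE linearP scalerDr !scalerA mulrC.
Qed.
Definition opi v X : {linear oplus v X -> X v} := lin (@opi_linear v X).

Lemma opiE v X (y : oplus v X) :
  opi v X y = \sum_(a : into v | tag a \notin I)
    eps K (tagged a) *: rmap X (tagged a) (y a).
Proof. by []. Qed.

Definition oeq v X (y z : oplus v X) := forall a, tag a \notin I -> y a = z a.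

Lemma opi_ext v X (y z : oplus v X) : oeq y z -> opi v X y = opi v X z.
Proof. by move=> yz; apply: eq_bigr => a aI; rewrite yz. Qed.

Definition only v w (b : darr w v) :=
  forall c : into v, (tag c \in I) = (c == to_into b).

Section Only.
Variables (v w : Q) (b : darr w v).
Hypothesis ob : only b.

Lemma pi_split X (y : oplus v X) :
  pi v X y = eps K b *: rmap X b (y (to_into b)) + opi v X y.
Proof.
rewrite piE (bigID (fun a : into v => tag a \in I)); congr (_ + _).
by rewrite (big_pred1 (to_into b)).
Qed.

(** Provides inputs for the exactness hypotheses: the component along [b] can be prescribed
    independently of the others. *)
Lemma glue X (z : X w) (r : oplus v X) :
  exists y : oplus v X, y (to_into b) = z /\ oeq y r.
Proof.
exists (dinj (to_into b) (z - r (to_into b)) + r); split.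
  by rewrite dsumDE dinj_eq subrK.
move=> a; rewrite ob => ab; rewrite dsumDE dinj_neq ?add0r //.
by rewrite eq_sym.
Qed.

Lemma only_ext X (y z : oplus v X) :
  y (to_into b) = z (to_into b) -> oeq y z -> y = z.
Proof.
move=> yzb yz; apply: dsumP => a.
by have [aI|/yz //] := boolP (tag a \in I); move: aI; rewrite ob => /eqP ->.
Qed.

End Only.

Section Step.
Variables (p : Q) (lp : K) (V X : rep) (e : family V X) (h : family X V).
Hypotheses (pI : p \in I) (st : step p lp e h).

Lemma out_neq k : k \notin I -> p != k.
Proof. by apply: contraNneq => <-. Qed.

Lemma step_opi v y : p != v -> opi v X (omapf e v y) = e v (opi v V y).
Proof.
move=> pv; rewrite !opiE linear_sum; apply: eq_bigr => a aI.
by rewrite omapfE (step1 st) ?linearZZ //; apply: out_neq.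
Qed.

(** The path runs from outside [I] through [p] to a vertex of [I]; its ends differ, so the
    correction vanishes. The same holds in [step_mu_arr] in the opposite direction. *)
Lemma step_opi_arr w (b : darr p w) y : w \in I ->
  rmap X b (opi p X (omapf e p y)) = e w (rmap V b (opi p V y)).
Proof.
move=> wI; rewrite !opiE !linear_sum; apply: eq_bigr => a aI.
rewrite omapfE !linearZZ (step2 st) delta_neq ?scaler0 ?subr0 //.
by apply: contraNneq aI => ->.
Qed.

Lemma step_mu v x : p != v -> oeq (mu v X (e v x)) (omapf e v (mu v V x)).
Proof. by move=> pv a aI; rewrite omapfE !muE (step1 st) //; apply: out_neq. Qed.

Lemma step_mu_arr w (b : darr w p) x : w \in I ->
  oeq (mu p X (rmap X b (e w x))) (omapf e p (mu p V (rmap V b x))).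
Proof.
move=> wI a aI; rewrite omapfE !muE (step2 st) delta_neq ?scaler0 ?subr0 //.
by apply: contraNneq aI => <-.
Qed.

Lemma omapf_oeq v y z : oeq y z -> oeq (omapf e v y) (omapf e v z).
Proof. by move=> yz a aI; rewrite !omapfE yz. Qed.

Lemma omapf_back v y : oeq (omapf e v (omapf h v y)) y.
Proof. by move=> a aI; rewrite !omapfE (step_hK st) // out_neq. Qed.

Lemma omapf_inj v y z : oeq (omapf e v y) (omapf e v z) -> oeq y z.
Proof.
move=> yz a aI; have := yz a aI; rewrite !omapfE.
by apply: can_inj; apply: (step_eK st); apply: out_neq.
Qed.

End Step.
End Outer.

(** * Generators and relations for the triple cokernel reflection *)

Section CokernelBraid.
Variables (K : fieldType) (Q : quiver).
Local Notation rep := (rep K (double Q)).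
Local Notation family V W := (forall k : Q, {linear V k -> W k}).
Variables (i j : Q) (b : darr j i).
Local Notation I := [set i; j].
Local Notation bs := (star b).
Hypotheses (ij : i != j) (ob : only I b) (obs : only I bs).
Variables (V V1 V2 V3 : rep) (l1 l2 l3 : K).
Variables (e1 : family V V1) (h1 : family V1 V).
Variables (e2 : family V1 V2) (h2 : family V2 V1).
Variables (e3 : family V2 V3) (h3 : family V3 V2).
Hypotheses (s1 : step i l1 e1 h1) (s2 : step j l2 e2 h2) (s3 : step i l3 e3 h3).
Hypotheses (c1 : cok_exact i e1) (c2 : cok_exact j e2) (c3 : cok_exact i e3).

Let iI : i \in I. Proof. by rewrite set21. Qed.
Let jI : j \in I. Proof. by rewrite set22. Qed.
Let ji : j != i. Proof. by rewrite eq_sym. Qed.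
Let epsbs : eps K bs = - eps K b. Proof. exact: eps_star. Qed.

(* The generating maps of C_j C_i V at j and of C_i C_j C_i V at i. *)
Definition stage2 (r : oplus i V) (s : oplus j V) : V2 j :=
  opi I j V2 (omapf e2 j (omapf e1 j s)) +
  eps K bs *: rmap V2 bs (e2 i (opi I i V1 (omapf e1 i r))).

Let mu_bs (X : rep) (x : X j) : mu j X x (to_into bs) = rmap X b x.
Proof. by rewrite muE /= starK. Qed.

Let mu_b (X : rep) (x : X i) : mu i X x (to_into b) = rmap X bs x.
Proof. exact: muE. Qed.

(** This is pi mu = 0 at [j] in V2, split into the component along [bs] and the rest. It turns a
    path from [j] through [i] back to [j] into outer generators. *)
Let cok2_mu v : eps K bs *: rmap V2 bs (e2 i (rmap V1 b (e1 j v))) +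
  opi I j V2 (omapf e2 j (omapf e1 j (mu j V v))) = 0.
Proof.
rewrite -[RHS](_ : pi j V2 (omapf e2 j (mu j V1 (e1 j v))) = 0); last first.
  by apply/c2.2; exists (e1 j v).
rewrite (pi_split obs) omapfE mu_bs; congr (_ + _); apply: opi_ext.
by apply: omapf_oeq => a aI; rewrite (step_mu iI s1).
Qed.

Lemma stage2_gen x : exists r s, x = stage2 r s.
Proof.
have [y ->] := c2.1 x; have [z yz] := c1.1 (y (to_into bs)).
(* Lifting x and then the component at [i] leaves an unwanted component of z at [j]; the term in
   [mu] is what [cok2_mu] substitutes for it. *)
exists z, (omapf h1 j y - eps K b *: mu j V (z (to_into b))).
set v := z (to_into b); have /eqP := cok2_mu v; rewrite addrC addr_eq0 => /eqP m.
have back : opi I j V2 (omapf e2 j (omapf e1 j (omapf h1 j y))) =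
    opi I j V2 (omapf e2 j y).
  by apply: opi_ext; apply: omapf_oeq; apply: (omapf_back iI s1).
rewrite (pi_split obs) omapfE yz (pi_split ob) omapfE /stage2.
rewrite (linearD (e2 i)) (linearD (rmap V2 bs)) scalerDr.
rewrite (linearZZ (e2 i)) (linearZZ (rmap V2 bs)).
rewrite (linearB (omapf e1 j)) (linearB (omapf e2 j)) (linearB (opi I j V2)).
rewrite (linearZZ (omapf e1 j)) (linearZZ (omapf e2 j)) (linearZZ (opi I j V2)).
rewrite back m scalerN opprK !scalerA (mulrC (eps K b) (eps K bs)).
by rewrite addrC addrA.
Qed.

Lemma stage2_ker r s : stage2 r s = 0 <->
  exists u, oeq I r (mu i V u) /\
    oeq I s (eps K bs *: mu j V (rmap V bs u)).
Proof.
split=> [x0|[u [ru sv]]].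
  have [y [yb yo]] := glue obs (opi I i V1 (omapf e1 i r)) (omapf e1 j s).
  have /c2.2[w yw] : pi j V2 (omapf e2 j y) = 0.
    rewrite (pi_split obs) omapfE yb -x0 /stage2 addrC; congr (_ + _).
    exact/opi_ext/omapf_oeq.
  move: (step_hK s1 ij w) yb yo; rewrite {y}yw; move: (h1 j w) => v <-.
  rewrite mu_bs => nv yo; have sv : oeq I s (mu j V v).
    apply: (omapf_inj iI s1) => a aI.
    by rewrite -(step_mu iI s1) // yo.
  (* The component along [b] is chosen so that its contribution to [pi] cancels the outer sum;
     exactness then yields [u]. *)
  have [z [zb zo]] := glue ob (- eps K b *: v) r.
  have /c1.2[u zu] : pi i V1 (omapf e1 i z) = 0.
    rewrite (pi_split ob) omapfE zb (linearZZ (e1 j)) (linearZZ (rmap V1 b)).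
    rewrite scalerA mulrN eps_sq scaleN1r nv.
    by rewrite (opi_ext (omapf_oeq e1 zo)) addNr.
  have vu : v = eps K bs *: rmap V bs u.
    by move: zb; rewrite zu mu_b epsbs => ->; rewrite scalerA mulrNN eps_sq scale1r.
  exists u; split; first by move=> a aI; rewrite -zu zo.
  by rewrite -linearZZ -vu.
have /eqP : pi i V1 (omapf e1 i (mu i V u)) = 0 by apply/c1.2; exists u.
rewrite (pi_split ob) omapfE addrC addr_eq0 -(opi_ext (omapf_oeq e1 ru)) mu_b.
move=> /eqP opir; rewrite /stage2 opir -scaleNr -epsbs.
rewrite -(linearZZ (rmap V1 b)) -(linearZZ (e1 j)) addrC.
rewrite (opi_ext (omapf_oeq e2 (omapf_oeq e1 sv))) -(linearZZ (mu j V)).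
exact: cok2_mu.
Qed.

Definition stage3 (r : oplus i V) (s : oplus j V) : V3 i :=
  opi I i V3 (omapf e3 i (omapf e2 i (omapf e1 i r))) +
  eps K b *: rmap V3 b (e3 j (opi I j V2 (omapf e2 j (omapf e1 j s)))).

Let cok3_mu n : eps K b *: rmap V3 b (e3 j (rmap V2 bs (e2 i n))) +
  opi I i V3 (omapf e3 i (omapf e2 i (mu i V1 n))) = 0.
Proof.
rewrite -[RHS](_ : pi i V3 (omapf e3 i (mu i V2 (e2 i n))) = 0); last first.
  by apply/c3.2; exists (e2 i n).
rewrite (pi_split ob) omapfE mu_b; congr (_ + _); apply: opi_ext.
by apply: omapf_oeq => a aI; rewrite (step_mu jI s2).
Qed.

Lemma stage3_gen x : exists r s, x = stage3 r s.
Proof.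
have [y ->] := c3.1 x; have [r [s yb]] := stage2_gen (y (to_into b)).
set n := opi I i V1 (omapf e1 i r); have /eqP := cok3_mu n.
rewrite addr_eq0 => /eqP m.
have back z : opi I i V3 (omapf e3 i (omapf e2 i (omapf e1 i
    (omapf h1 i z)))) = opi I i V3 (omapf e3 i (omapf e2 i z)).
  by apply: opi_ext; do 2!apply: omapf_oeq; apply: (omapf_back iI s1).
have back2 z : opi I i V3 (omapf e3 i (omapf e2 i (omapf h2 i z))) =
    opi I i V3 (omapf e3 i z).
  by apply: opi_ext; apply: omapf_oeq; apply: (omapf_back jI s2).
(* The component of y at [j] has a part that comes from [n] at [i]; [cok3_mu] moves its image to
   outer generators, whence the term in [mu]. *)
exists (omapf h1 i (omapf h2 i y - eps K bs *: mu i V1 n)), s.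
rewrite (pi_split ob) omapfE yb /stage2 /stage3 back.
rewrite (linearB (omapf e2 i)) (linearB (omapf e3 i)) (linearB (opi I i V3)) back2.
rewrite (linearZZ (omapf e2 i)) (linearZZ (omapf e3 i)) (linearZZ (opi I i V3)).
rewrite (linearD (e3 j)) (linearD (rmap V3 b)) scalerDr.
rewrite (linearZZ (e3 j)) (linearZZ (rmap V3 b)) scalerA (mulrC (eps K b)).
by rewrite -scalerA m scalerN [LHS]addrC [RHS]addrAC addrA.
Qed.

(** Exactness of the third reflection gives n in V1_i whose outer components are [r]; exactness of
    the second gives v in V_j that determines both n and [s]. *)
Lemma stage3_ker r s : stage3 r s = 0 <->
  exists v, oeq I s (mu j V v) /\ oeq I r (eps K b *: mu i V (rmap V b v)).
Proof.
split=> [x0|[v [sv rv]]].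
  have [y [yb yo]] := glue ob (opi I j V2 (omapf e2 j (omapf e1 j s)))
    (omapf e2 i (omapf e1 i r)).
  have /c3.2[w yw] : pi i V3 (omapf e3 i y) = 0.
    rewrite (pi_split ob) omapfE yb -x0 /stage3 addrC; congr (_ + _).
    exact/opi_ext/omapf_oeq.
  move: (step_hK s2 ji w) yb yo; rewrite {y}yw; move: (h2 i w) => n <-.
  rewrite mu_b => nb yo; have rn : oeq I (omapf e1 i r) (mu i V1 n).
    apply: (omapf_inj jI s2) => a aI.
    by rewrite -(step_mu jI s2) // yo.
  have [z [zb zo]] := glue obs (- eps K bs *: n) (omapf e1 j s).
  have /c2.2[w' zw] : pi j V2 (omapf e2 j z) = 0.
    rewrite (pi_split obs) omapfE zb (linearZZ (e2 i)) (linearZZ (rmap V2 bs)).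
    rewrite scalerA mulrN eps_sq scaleN1r nb.
    by rewrite (opi_ext (omapf_oeq e2 zo)) addNr.
  move: (step_hK s1 ij w') zb zo; rewrite {z}zw; move: (h1 j w') => v <-.
  rewrite mu_bs epsbs opprK => nv so; have sv : oeq I s (mu j V v).
    apply: (omapf_inj iI s1) => a aI.
    by rewrite -(step_mu iI s1) // so.
  exists v; split=> //; apply: (omapf_inj iI s1) => a aI.
  rewrite (linearZZ (omapf e1 i)) dsumZE -(step_mu_arr s1 _ _ jI) // nv.
  by rewrite (linearZZ (mu i V1)) dsumZE scalerA eps_sq scale1r rn.
have vb : oeq I (mu i V1 (eps K b *: rmap V1 b (e1 j v))) (omapf e1 i r).
  move=> a aI; rewrite (linearZZ (mu i V1)) dsumZE (step_mu_arr s1 _ _ jI) //.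
  by rewrite (omapf_oeq e1 rv) // (linearZZ (omapf e1 i)) dsumZE.
rewrite /stage3 -(opi_ext (omapf_oeq e3 (omapf_oeq e2 vb))).
have sb : opi I j V2 (omapf e2 j (omapf e1 j s)) =
    rmap V2 bs (e2 i (eps K b *: rmap V1 b (e1 j v))).
  rewrite (opi_ext (omapf_oeq e2 (omapf_oeq e1 sv))).
  have /eqP := cok2_mu v; rewrite epsbs scaleNr addrC subr_eq0 => /eqP ->.
  by rewrite (linearZZ (e2 i)) (linearZZ (rmap V2 bs)).
by rewrite sb addrC cok3_mu.
Qed.

End CokernelBraid.

(** * Functors presented by generators and relations *)

Section Presentations.
Variables (K : fieldType) (Q : quiver) (I : {set Q}).
Local Notation rep := (rep K (double Q)).
Local Notation family V W := (forall k : Q, {linear V k -> W k}).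
Implicit Types (u v w k l p : Q).

Lemma only_tag v w w' (b : darr w v) (b' : darr w' v) :
  only I b -> w' \in I -> exists e : w' = w, ecast z (darr z v) e b' = b.
Proof.
move=> ob wI; have /eqP e : to_into b' == to_into b by rewrite -ob.
have ew : w = w' := congr1 (fun u : into v => tag u) (esym e).
case: w' / ew b' wI e => b' _ /eqP; rewrite eq_Tagged /= => /eqP ->.
by exists erefl.
Qed.

(** Since [g] vanishes on [I], [pi] after [omapf g] only sees the arrows from outside. *)
Lemma gen_only v w (b : darr w v) (V X : rep) (g : family V X) r s :
  (forall k x, k \in I -> g k x = 0) -> only I b ->
  gen I g r s = opi I v X (omapf g v r) +
    eps K b *: rmap X b (opi I w X (omapf g w (s w))).
Proof.
move=> g0 ob; have piE k y : pi k X (omapf g k y) = opi I k X (omapf g k y).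
  rewrite piE (bigID (fun a : into k => tag a \in I)) /= big1 ?add0r //.
  by move=> a aI; rewrite omapfE g0 // linear0 scaler0.
rewrite /gen piE; congr (_ + _).
by rewrite (big_pred1 (to_into b)) // piE.
Qed.

Lemma gen_no_inner v (V X : rep) (g : family V X) r s :
  (forall a : into v, tag a \notin I) -> gen I g r s = pi v X (omapf g v r).
Proof. by move=> no; rewrite /gen big_pred0 ?addr0 // => a; apply/negbTE. Qed.

(* The image of V_w in R + S; only one pair (w, b) contributes. *)
Definition braid_ker (V : rep) v (r : oplus v V) (s : forall w, oplus w V) : Prop :=
  exists w (b : darr w v) (x : V w),
    [/\ w \in I, oeq I (s w) (mu w V x)
      & oeq I r (eps K b *: mu v V (rmap V b x))].

Lemma braid_kerP v w (b : darr w v) (V : rep) (r : oplus v V) s :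
  only I b -> w \in I ->
  braid_ker r s <-> exists x, oeq I (s w) (mu w V x) /\
    oeq I r (eps K b *: mu v V (rmap V b x)).
Proof.
move=> ob wI; split=> [[w' [b' [x [w'I sx rx]]]]|[x [sx rx]]]; last first.
  by exists w, b, x.
have [e <-] := only_tag b' ob w'I.
by case: w / e b ob wI => b ob wI /=; exists x.
Qed.

Lemma gen_natural (V W X Y : rep) (g : family V X) (g' : family W Y)
    (f : rhom V W) (phi : rhom X Y) v r (s : forall w, oplus w V) :
  (forall k x, phi k (g k x) = g' k (f k x)) ->
  phi v (gen I g r s) = gen I g' (omap v f r) (fun w => omap w f (s w)).
Proof.
move=> nat.
have piE k y : phi k (pi k X (omapf g k y)) = pi k Y (omapf g' k (omap k f y)).
  rewrite -pi_omap; congr (pi _ _ _).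
  by apply: dsumP => a; rewrite !(omapE, omapfE) nat.
rewrite /gen linearD piE linear_sum; congr (_ + _); apply: eq_bigr => a _.
by rewrite linearZZ rhP piE.
Qed.

Variables (nu : Q -> K) (lam mu : {ffun Q -> K}).
Implicit Types F G : functor (ModPi lam) (ModPi mu).

(** The relations [Kn] and the scalars [nu] refer to V alone, so they can be shared by two functors
    built in different ways. *)
Definition cok_presented
    (Kn : forall (V : pirep lam) v, oplus v V -> (forall w, oplus w V) -> Prop)
    F : Prop :=
  exists (g : forall V : pirep lam, family V (F V : pirep mu))
         (h : forall V : pirep lam, family (F V : pirep mu) V),
  [/\ forall V, frame I nu (g V) (h V),
      forall (V W : pirep lam) (f : rhom V W) k x,
        (fmap F (f : chom (V : ModPi lam) W) : rhom _ _) k (g V k x) =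
          g W k (f k x),
      forall V v x, v \in I -> exists r s, x = gen I (g V) (v := v) r s
    & forall V v r s, v \in I -> gen I (g V) (v := v) r s = 0 <-> Kn V v r s].

(** Equal kernels make [crel] single-valued in both directions. It remains to present one composite,
    with data symmetric in [i] and [j]. *)
Lemma cok_presented_iso Kn F G : inner_unique I ->
  cok_presented Kn F -> cok_presented Kn G -> functor_iso F G.
Proof.
move=> iu [g [h [fg nat gen_g ker_g]]] [g' [h' [fg' nat' gen_g' ker_g']]].
pose rho (V : pirep lam) v (x : (F V : pirep mu) v) (y : (G V : pirep mu) v) :=
  crel I (g V) (g' V) x y.
apply: (@functor_iso_linrel _ _ _ _ F G rho) => [V|V|V W f v x y].
- apply: (crel_linrel iu (fg V) (fg' V) (@pirepP _ _ _ _) (@pirepP _ _ _ _)).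
    exact: gen_g.
  by move=> v r s vI e; apply/ker_g' => //; apply/ker_g.
- apply: (@linrel_iff _ _ _ _
    (fun v (y : (G V : pirep mu) v) x => crel I (g' V) (g V) y x)).
    by move=> v x y; split=> /crelC.
  apply: (crel_linrel iu (fg' V) (fg V) (@pirepP _ _ _ _) (@pirepP _ _ _ _)).
    exact: gen_g'.
  by move=> v r s vI e; apply/ker_g => //; apply/ker_g'.
case=> xo xi; split=> [/xo[m [-> ->]]|/xi[r [s [-> ->]]]].
  by exists (f v m); rewrite nat nat'.
exists (@omap K Q v _ _ f r), (fun w => @omap K Q w _ _ f (s w)).
by split; apply: gen_natural => k z; [apply: nat | apply: nat'].
Qed.

End Presentations.

(** * Arrows inside a pair of loop-free vertices *)

Section Pair.
Variables (K : fieldType) (Q : quiver) (i j : Q).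
Hypotheses (ij : i != j) (loopi : loopfree i) (loopj : loopfree j).
Local Notation I := [set i; j].

Lemma only_single (b : darr j i) : #|darr j i| = 1%N -> only I b.
Proof.
move=> one [w c] /=; apply/idP/eqP => [/set2P[] e|e]; last first.
- by have -> : w = j := congr1 (fun u : into i => tag u) e; rewrite set22.
- subst w; congr Tagged.
  have /fintype_le1P all1 : (#|darr j i| <= 1)%N by rewrite one.
  exact: all1.
- by subst w; have := no_loop (j := j) loopi loopj c; rewrite set21.
Qed.

Lemma inner_unique_single (b : darr j i) (b' : darr i j) :
  only I b -> only I b' -> inner_unique I.
Proof.
move=> ob ob' v c c' /set2P[] ?; subst v; first by rewrite !ob => /eqP -> /eqP ->.
by rewrite !ob' => /eqP -> /eqP ->.
Qed.

Lemma no_inner : #|darr i j| = 0%N -> forall v, v \in I ->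
  forall a : into v, tag a \notin I.
Proof.
move=> no v vI [w a] /=; apply/negP => wI.
case/set2P: vI => ?; case/set2P: wI => ?; subst v w.
- by have := no_loop (j := j) loopi loopj a; rewrite set21.
- by have /card0_eq/(_ (star a)) := no.
- by have /card0_eq/(_ a) := no.
- by have := no_loop (i := i) loopi loopj a; rewrite set22.
Qed.

End Pair.

Lemma card_darrC (Q : quiver) (i j : Q) : #|darr i j| = #|darr j i|.
Proof. by rewrite !card_double_arr addnC. Qed.

Section KeepNatural.
Variables (K : fieldType) (Q : quiver) (i k : Q) (V W : rep K (double Q)).
Variables (N M : lmodType K) (f : rhom V W) (n : {linear N -> M}).
Variables (b : bool) (r : reflect (i = k) b).

Lemma replace_map_at_keep x :
  replace_map_at f n r (keep_at V N r x) = keep_at W M r (f k x).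
Proof.
by rewrite !linE /keep_at_fun; case: r => [e|ne] //; apply: (linear0 n).
Qed.

Lemma replace_map_at_back x :
  back_at W M r (replace_map_at f n r x) = f k (back_at V N r x).
Proof.
rewrite !linE /back_at_fun; case: r x => [e|ne] x //.
by rewrite (linear0 (f k)).
Qed.

End KeepNatural.

Lemma omapf_famcomp (K : fieldType) (Q : quiver) (U V W : rep K (double Q))
    (f : forall k : Q, {linear V k -> W k}) (g : forall k : Q, {linear U k -> V k})
    (v : Q) y :
  omapf (famcomp f g) v y = omapf f v (omapf g v y).
Proof. by apply: dsumP => a; rewrite !omapfE. Qed.

Section NoInner.
Variables (K : fieldType) (Q : quiver) (I : {set Q}) (v : Q).
Hypothesis no : forall a : into v, tag a \notin I.

Lemma oeq_eq (X : rep K (double Q)) (y z : oplus v X) : oeq I y z -> y = z.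
Proof. by move=> yz; apply: dsumP => a; apply: yz. Qed.

Lemma pi_opi (X : rep K (double Q)) (y : oplus v X) : pi v X y = opi I v X y.
Proof. by rewrite piE opiE; apply: eq_bigl => a; rewrite no. Qed.

End NoInner.

(** * Two cokernel reflections at unconnected vertices *)

Section CokernelPair.
Variables (K : fieldType) (Q : quiver) (i j : Q).
Local Notation rep := (rep K (double Q)).
Local Notation family V W := (forall k : Q, {linear V k -> W k}).
Local Notation I := [set i; j].
Hypotheses (ij : i != j).
Hypothesis no : forall v, v \in I -> forall a : into v, tag a \notin I.
Variables (V V1 V2 : rep) (l1 l2 : K).
Variables (e1 : family V V1) (h1 : family V1 V).
Variables (e2 : family V1 V2) (h2 : family V2 V1).
Hypotheses (s1 : step j l1 e1 h1) (s2 : step i l2 e2 h2).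
Hypotheses (c1 : cok_exact j e1) (c2 : cok_exact i e2).

Let iI : i \in I. Proof. by rewrite set21. Qed.
Let jI : j \in I. Proof. by rewrite set22. Qed.
Let ji : j != i. Proof. by rewrite eq_sym. Qed.
Let noi := no iI.
Let noj := no jI.

(** At [i] the generators are those of the second reflection, its input being identified with V by
    the first; at [j] they are those of the first, transported by [e2]. *)
Lemma pair_gen v x : v \in I ->
  exists y, x = pi v V2 (omapf (famcomp e2 e1) v y).
Proof.
case/set2P => ?; subst v.
  have [y ->] := c2.1 x; exists (omapf h1 i y); rewrite omapf_famcomp.
  by rewrite (oeq_eq noi (omapf_back jI s1 y)).
have [y e] := c1.1 (h2 j x); exists y.
rewrite omapf_famcomp (pi_opi noj) (step_opi iI s2) // -(pi_opi noj) -e.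
by rewrite (step_hK s2).
Qed.

Lemma pair_ker v y : v \in I ->
  pi v V2 (omapf (famcomp e2 e1) v y) = 0 <-> exists x, y = mu v V x.
Proof.
case/set2P => ?; subst v; rewrite omapf_famcomp.
  apply: iff_trans (c2.2 _) _; split=> [[w yw]|[x ->]].
    exists (h1 i w); apply: (oeq_eq noi); apply: (omapf_inj jI s1) => a aI.
    by rewrite -(step_mu jI s1) // (step_hK s1) // yw.
  exists (e1 i x); apply: (oeq_eq noi) => a aI.
  by rewrite -(step_mu jI s1).
rewrite (pi_opi noj) (step_opi iI s2) // -(pi_opi noj).
apply: iff_trans (c1.2 _); split=> [e|->]; last by rewrite linear0.
by rewrite -(step_eK s2 ij (pi _ _ _)) e linear0.
Qed.

End CokernelPair.

(** * Presentations of the composite cokernel functors *)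

Section CokernelPresentations.
Variables (K : fieldType) (Q : quiver).
Local Notation rep := (rep K (double Q)).
Local Notation family V W := (forall k : Q, {linear V k -> W k}).

Section Kept.
Variables (i : Q) (li : loopfree i) (lam : {ffun Q -> K}).

Definition cok_keep (V : pirep lam) : family V (cok_obj li V) :=
  keep (cproj (mu i V)) (cgamma i V).
Definition cok_back (V : pirep lam) : family (cok_obj li V) V :=
  back (cproj (mu i V)) (cgamma i V).

Lemma cok_keep_natural (V W : pirep lam) (f : rhom V W) (k : Q) x :
  cok_map li f k (cok_keep V k x) = cok_keep W k (f k x).
Proof. exact: replace_map_at_keep. Qed.

Lemma cok_step V : step i (lam i) (cok_keep V) (cok_back V).
Proof. exact/step_replace/cgammaE. Qed.

Lemma cok_keep_exact V : cok_exact i (cok_keep V).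
Proof. exact: cok_stepP. Qed.

End Kept.

Lemma cok_presented_cast I nu (lam m m' : {ffun Q -> K}) (e : m = m') Kn
    (F : functor (ModPi lam) (ModPi m)) :
  cok_presented I nu Kn F -> cok_presented I nu Kn (mod_cast e \of F).
Proof. by move=> [g [h P]]; exists g, h. Qed.

Lemma cok_presented_commute (i j : Q) (li : loopfree i) (lj : loopfree j) (lam : {ffun Q -> K}) :
  i != j -> #|arrows_between i j| = 0%N ->
  cok_presented [set i; j] lam (fun V v r _ => exists x, r = mu v V x)
    (cok_refl (wrefl j lam) li \of cok_refl lam lj).
Proof.
move=> ij no; have no' : #|darr i j| = 0%N by rewrite -card_arrows_between.
(* Without arrows the reflection at [j] keeps the parameter at [i], so the frame has scalars [lam]
   in either order. *)
have si : wrefl j lam i = lam i.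
  by rewrite wreflE symformC symform_neq // no oppr0 mul0r subr0.
exists (fun V => famcomp (cok_keep li (cok_obj lj V)) (cok_keep lj V)).
exists (fun V => famcomp (cok_back lj V) (cok_back li (cok_obj lj V))).
have out := no_inner li lj no'.
split=> [V|V W f k x|V v x vI|V v r s vI].
- apply: frame_two => //; first exact: cok_step.
  by rewrite -si; apply: cok_step.
- rewrite !famcompE.
  exact: etrans (cok_keep_natural _ _ _) (congr1 _ (cok_keep_natural _ _ _)).
- have [r ->] := pair_gen ij out (cok_step lj V) (cok_step li _)
    (cok_keep_exact lj V) (cok_keep_exact li _) x vI.
  exists r, (fun w => 0); rewrite gen_no_inner //; exact: out.
- rewrite gen_no_inner; last exact: out.
  exact: (pair_ker ij out (cok_step lj V) (cok_step li _)
    (cok_keep_exact lj V) (cok_keep_exact li _) r vI).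
Qed.

Lemma cok_presented_braid (i j : Q) (li : loopfree i) (lj : loopfree j)
    (lam : {ffun Q -> K}) :
  i != j -> #|arrows_between i j| = 1%N ->
  cok_presented [set i; j] (fun=> lam i + lam j)
    (fun V v r s => braid_ker [set i; j] r s)
    (cok_refl (wrefl j (wrefl i lam)) li \of cok_refl (wrefl i lam) lj
       \of cok_refl lam li).
Proof.
move=> ij one; have one' : #|darr i j| = 1%N by rewrite -card_arrows_between.
have /card_gt0P[b _] : (0 < #|darr j i|)%N by rewrite card_darrC one'.
have ob : only [set i; j] b by apply: only_single; rewrite // card_darrC.
have obs : only [set i; j] (star b) by rewrite setUC; apply: only_single.
have cij := symform_neq K ij; have cji := symformC K j i; rewrite cij one in cji.
(* The successive parameters are lam_i, lam_i + lam_j and lam_j, as [frame_three] requires, and the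
   resulting scalar is symmetric. *)
have l2 : wrefl i lam j = lam i + lam j by rewrite wreflE cij one; ring.
have l3 : lam i + wrefl j (wrefl i lam) i = lam i + lam j.
  by rewrite wreflE l2 cji wreflE symform_loopfree //; ring.
pose V1 (V : pirep lam) := cok_obj li V.
pose V2 (V : pirep lam) := cok_obj lj (V1 V).
exists (fun V => famcomp (cok_keep li (V2 V))
  (famcomp (cok_keep lj (V1 V)) (cok_keep li V))).
exists (fun V => famcomp (cok_back li V)
  (famcomp (cok_back lj (V1 V)) (cok_back li (V2 V)))).
have fr V : frame [set i; j] (fun=> lam i + lam j)
    (famcomp (cok_keep li (V2 V)) (famcomp (cok_keep lj (V1 V)) (cok_keep li V)))
    (famcomp (cok_back li V) (famcomp (cok_back lj (V1 V)) (cok_back li (V2 V)))).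
  apply: (frame_three ij li lj (cok_step _ _) _ (cok_step _ _) l3).
  by rewrite -l2; apply: cok_step.
have ji : j != i by rewrite eq_sym.
have gen_i (V : pirep lam) (r : oplus i V) (s : forall w, oplus w V) :
    gen [set i; j] (famcomp (cok_keep li (V2 V))
      (famcomp (cok_keep lj (V1 V)) (cok_keep li V))) r s =
    stage3 b (cok_keep li V) (cok_keep lj (V1 V)) (cok_keep li (V2 V)) r (s j).
  rewrite (gen_only _ _ (frame_g0 (fr V)) ob) /stage3 !omapf_famcomp.
  by rewrite (step_opi (set21 i j) (cok_step li (V2 V)) _ ij).
(* The third reflection is an identification at [j], so the generators there are those of the second
   stage, with R and S exchanged. *)
have gen_j (V : pirep lam) (r : oplus j V) (s : forall w, oplus w V) :
    gen [set i; j] (famcomp (cok_keep li (V2 V))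
      (famcomp (cok_keep lj (V1 V)) (cok_keep li V))) r s =
    cok_keep li (V2 V) j
      (stage2 b (cok_keep li V) (cok_keep lj (V1 V)) (s i) r).
  rewrite (gen_only _ _ (frame_g0 (fr V)) obs) /stage2 !omapf_famcomp.
  rewrite (step_opi (set21 i j) (cok_step li (V2 V)) _ ij).
  rewrite (step_opi_arr (cok_step li (V2 V))) ?set22 //.
  rewrite (step_opi (set22 i j) (cok_step lj (V1 V)) _ ji).
  by rewrite [in RHS]linearD linearZZ.
split=> // [V W f k x|V v x vI|V v r s vI].
- rewrite !famcompE.
  apply: etrans (cok_keep_natural _ _ _) (congr1 _ _).
  exact: etrans (cok_keep_natural _ _ _) (congr1 _ (cok_keep_natural _ _ _)).
- case/set2P: vI => ?; subst v.
    have [r [s ->]] := stage3_gen ij ob obs (cok_step li V) (cok_step lj (V1 V))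
      (cok_keep_exact li V) (cok_keep_exact lj (V1 V)) (cok_keep_exact li (V2 V)) x.
    exists r, (dfwith (fun w => 0 : oplus w V) (s : oplus j V)).
    by rewrite gen_i dfwith_in.
  have [r [s e]] := stage2_gen ij ob obs (cok_step li V)
    (cok_keep_exact li V) (cok_keep_exact lj (V1 V)) (cok_back li (V2 V) j x).
  exists s, (dfwith (fun w => 0 : oplus w V) (r : oplus i V)).
  by rewrite gen_j dfwith_in -e (step_hK (cok_step li (V2 V))).
case/set2P: vI => ?; subst v.
  rewrite gen_i; apply: iff_trans (iff_sym (braid_kerP _ _ ob (set22 i j))).
  exact: (stage3_ker ij ob obs (cok_step li V) (cok_step lj (V1 V))
      (cok_keep_exact lj (V1 V)) (cok_keep_exact li (V2 V)) r (s j)).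
rewrite gen_j; apply: iff_trans (iff_sym (braid_kerP _ _ obs (set21 i j))).
have k2 := stage2_ker ij ob obs (cok_step li V) (cok_keep_exact li V)
  (cok_keep_exact lj (V1 V)) (s i) r.
apply: iff_trans k2; split=> [e|->]; last by rewrite linear0.
by rewrite -(step_eK (cok_step li (V2 V)) ij (stage2 _ _ _ _ _)) e linear0.
Qed.

End CokernelPresentations.

(** * Cogenerators of the triple kernel reflection *)

Section KernelBraid.
Variables (K : fieldType) (Q : quiver).
Local Notation rep := (rep K (double Q)).
Local Notation family V W := (forall k : Q, {linear V k -> W k}).
Variables (i j : Q) (b : darr j i).
Local Notation I := [set i; j].
Local Notation bs := (star b).
Hypotheses (ij : i != j) (ob : only I b) (obs : only I bs).
Variables (V V1 V2 V3 : rep) (l1 l2 l3 : K).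
Variables (e1 : family V V1) (h1 : family V1 V).
Variables (e2 : family V1 V2) (h2 : family V2 V1).
Variables (e3 : family V2 V3) (h3 : family V3 V2).
Hypotheses (s1 : step i l1 e1 h1) (s2 : step j l2 e2 h2) (s3 : step i l3 e3 h3).
Hypotheses (k1 : ker_exact i e1) (k2 : ker_exact j e2) (k3 : ker_exact i e3).

Let iI : i \in I. Proof. by rewrite set21. Qed.
Let jI : j \in I. Proof. by rewrite set22. Qed.
Let ji : j != i. Proof. by rewrite eq_sym. Qed.
Let epsbs : eps K bs = - eps K b. Proof. exact: eps_star. Qed.

Let mu_bs (X : rep) (x : X j) : mu j X x (to_into bs) = rmap X b x.
Proof. by rewrite muE /= starK. Qed.

Let mu_b (X : rep) (x : X i) : mu i X x (to_into b) = rmap X bs x.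
Proof. exact: muE. Qed.

(** [mu] of x has all its components away from [i], so [h] brings it back to X, where exactness puts
    it in the kernel of [pi]. *)
Let lift_i l (X Y : rep) (e : family X Y) (h : family Y X) x :
  step i l e h -> ker_exact i e ->
  exists y : oplus i X, [/\ pi i X y = 0, y (to_into b) = h j (rmap Y bs x)
    & oeq I (omapf e i y) (mu i Y x)].
Proof.
move=> s k; have he : omapf e i (omapf h i (mu i Y x)) = mu i Y x.
  apply: (only_ext ob); last exact: (omapf_back iI s).
  by rewrite !omapfE (step_hK s).
exists (omapf h i (mu i Y x)); split; first by apply/k.2; exists x.
  by rewrite omapfE mu_b.
by rewrite he.
Qed.

Let lift_j l (X Y : rep) (e : family X Y) (h : family Y X) x :
  step j l e h -> ker_exact j e ->
  exists y : oplus j X, [/\ pi j X y = 0, y (to_into bs) = h i (rmap Y b x)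
    & oeq I (omapf e j y) (mu j Y x)].
Proof.
move=> s k; have he : omapf e j (omapf h j (mu j Y x)) = mu j Y x.
  apply: (only_ext obs); last exact: (omapf_back jI s).
  by rewrite !omapfE (step_hK s).
exists (omapf h j (mu j Y x)); split; first by apply/k.2; exists x.
  by rewrite omapfE mu_bs.
by rewrite he.
Qed.

(** The dual of [stage2], from V2_j to R + S. It is a relation because only the components of [r]
    and [s] from outside are determined. *)
Definition out2 (x : V2 j) (r : oplus i V) (s : oplus j V) : Prop :=
  oeq I (mu j V2 x) (omapf e2 j (omapf e1 j s)) /\
  oeq I (mu i V2 (rmap V2 b x)) (omapf e2 i (omapf e1 i r)).

Lemma out2_im r s :
  (exists x, out2 x r s) <-> opi I i V r + rmap V b (opi I j V s) = 0.
Proof.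
split=> [[x [xs xr]]|rs].
  have [y [y0 yb yo]] := lift_j x s2 k2.
  set n := h2 i (rmap V2 b x) in yb.
  have xn : rmap V2 b x = e2 i n by rewrite (step_hK s2).
  have ys : oeq I y (omapf e1 j s).
    by apply: (omapf_inj jI s2) => a aI; rewrite yo // xs.
  have [z [z0 zb zo]] := lift_i n s1 k1.
  have zr : oeq I z r.
    apply: (omapf_inj iI s1) => a aI; rewrite zo //; move: a aI.
    apply: (omapf_inj jI s2) => a aI.
    by rewrite -(step_mu jI s2) // -xn xr.
  move: y0; rewrite (pi_split obs) yb (opi_ext ys) (step_opi iI s1) //.
  rewrite epsbs scaleNr addrC => /eqP; rewrite subr_eq0 => /eqP sn.
  move: z0; rewrite (pi_split ob) zb (opi_ext zr) => <-; rewrite addrC.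
  congr (_ + _); rewrite -linearZZ; congr (rmap V b _).
  by rewrite -(step_eK s1 ij (opi I j V s)) sn linearZZ.
(* With this component along [b], [pi] of z is the given sum, hence 0. Exactness then provides n,
   and gluing n to [s] provides x. *)
have [z [zb zo]] := glue ob (eps K b *: opi I j V s) r.
have /k1.2[n zn] : pi i V z = 0.
  rewrite (pi_split ob) zb (opi_ext zo) linearZZ scalerA eps_sq scale1r.
  by rewrite addrC.
have nb : rmap V1 bs n = e1 j (eps K b *: opi I j V s).
  by rewrite -mu_b -zn omapfE zb.
have [y [yb yo]] := glue obs n (omapf e1 j s).
have /k2.2[x yx] : pi j V1 y = 0.
  rewrite (pi_split obs) yb (opi_ext yo) nb (step_opi iI s1) //.
  by rewrite (linearZZ (e1 j)) scalerA epsbs mulNr eps_sq scaleN1r addNr.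
have xb : rmap V2 b x = e2 i n by rewrite -mu_bs -yx omapfE yb.
exists x; split; first by rewrite -yx; apply: omapf_oeq.
rewrite xb => a aI; rewrite (step_mu jI s2) // -zn.
by apply: omapf_oeq aI; apply: omapf_oeq.
Qed.

(** The kernel condition at [j] forces the arrow [bs] to kill the component n of x at [i];
    injectivity of [mu] for the first reflection gives n = 0, and for the second x = 0. *)
Lemma out2_inj x : out2 x 0 0 -> x = 0.
Proof.
move=> [xs xr]; have [y [y0 yb yo]] := lift_j x s2 k2.
set n := h2 i (rmap V2 b x) in yb.
have xn : rmap V2 b x = e2 i n by rewrite (step_hK s2).
have ys : oeq I y 0.
  apply: (omapf_inj jI s2) => a aI; rewrite yo // xs //.
  by rewrite !linear0.
have nr : oeq I (mu i V1 n) 0.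
  apply: (omapf_inj jI s2) => a aI.
  by rewrite -(step_mu jI s2) // -xn xr // !linear0.
move: y0; rewrite (pi_split obs) yb (opi_ext ys) linear0 addr0.
move=> /(congr1 ( *:%R (eps K bs))); rewrite scalerA eps_sq scale1r scaler0 => nb.
have n0 : n = 0.
  by apply: k1.1; apply: (only_ext ob) nr; rewrite mu_b nb dsum0E.
apply: k2.1; apply: (only_ext obs); first by rewrite mu_bs xn n0 linear0 dsum0E.
by move=> a aI; rewrite xs // !linear0.
Qed.

Definition out3 (x : V3 i) (r : oplus i V) (s : oplus j V) : Prop :=
  oeq I (mu i V3 x) (omapf e3 i (omapf e2 i (omapf e1 i r))) /\
  oeq I (mu j V3 (rmap V3 bs x)) (omapf e3 j (omapf e2 j (omapf e1 j s))).

Lemma out3_im r s :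
  (exists x, out3 x r s) <-> opi I j V s + rmap V bs (opi I i V r) = 0.
Proof.
split=> [[x [xr xs]]|rs].
  have [y [y0 yb yo]] := lift_i x s3 k3.
  set m := h3 j (rmap V3 bs x) in yb.
  have xm : rmap V3 bs x = e3 j m by rewrite (step_hK s3).
  have yr : oeq I y (omapf e2 i (omapf e1 i r)).
    by apply: (omapf_inj iI s3) => a aI; rewrite yo // xr.
  have [z [z0 zb zo]] := lift_j m s2 k2.
  have zs : oeq I z (omapf e1 j s).
    apply: (omapf_inj jI s2) => a aI; rewrite zo //; move: a aI.
    apply: (omapf_inj iI s3) => a aI.
    by rewrite -(step_mu iI s3) // -xm xs.
  move: y0; rewrite (pi_split ob) yb (opi_ext yr) (step_opi jI s2) //.
  move=> /eqP; rewrite addr_eq0 => /eqP /(congr1 ( *:%R (eps K b))).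
  rewrite scalerA eps_sq scale1r scalerN -scaleNr -epsbs => mb.
  move: z0; rewrite (pi_split obs) zb mb -(linearZZ (e2 i)) (step_eK s2) //.
  rewrite linearZZ scalerA eps_sq scale1r (opi_ext zs).
  rewrite (step_opi_arr s1) // (step_opi iI s1) // -linearD addrC => e0.
  by rewrite -(step_eK s1 ij (_ + _)) e0 linear0.
(* The arrow [bs] is applied to a sum computed in V1; the path through [i] has no correction, so the
   result is the one computed in V. *)
pose q := opi I i V1 (omapf e1 i r).
have qb : rmap V1 bs q = e1 j (rmap V bs (opi I i V r)).
  by rewrite (step_opi_arr s1).
have [z [zb zo]] := glue obs (eps K bs *: q) (omapf e1 j s).
have /k2.2[m zm] : pi j V1 z = 0.
  rewrite (pi_split obs) zb (opi_ext zo) linearZZ scalerA eps_sq scale1r.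
  by rewrite qb (step_opi iI s1) // -linearD addrC rs linear0.
have mb : rmap V2 b m = e2 i (eps K bs *: q) by rewrite -mu_bs -zm omapfE zb.
have [y [yb yo]] := glue ob m (omapf e2 i (omapf e1 i r)).
have /k3.2[x yx] : pi i V2 y = 0.
  rewrite (pi_split ob) yb (opi_ext yo) mb (step_opi jI s2) //.
  by rewrite (linearZZ (e2 i)) scalerA epsbs mulrN eps_sq scaleN1r addNr.
have xb : rmap V3 bs x = e3 j m by rewrite -mu_b -yx omapfE yb.
exists x; split; first by rewrite -yx; apply: omapf_oeq.
rewrite xb => a aI; rewrite (step_mu iI s3) // -zm.
by apply: omapf_oeq aI; apply: omapf_oeq.
Qed.

Lemma out3_inj x : out3 x 0 0 -> x = 0.
Proof.
move=> [xr xs]; have [y [y0 yb yo]] := lift_i x s3 k3.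
set m := h3 j (rmap V3 bs x) in yb.
have xm : rmap V3 bs x = e3 j m by rewrite (step_hK s3).
have yr : oeq I y 0.
  by apply: (omapf_inj iI s3) => a aI; rewrite yo // xr // !linear0.
move: y0; rewrite (pi_split ob) yb (opi_ext yr) linear0 addr0.
move=> /(congr1 ( *:%R (eps K b))); rewrite scalerA eps_sq scale1r scaler0 => mb.
have m0 : m = 0.
  apply: out2_inj; split; last by move=> a aI; rewrite mb !linear0.
  apply: (omapf_inj iI s3) => a aI.
  by rewrite -(step_mu iI s3) // -xm xs.
apply: k3.1; apply: (only_ext ob); first by rewrite mu_b xm m0 linear0 dsum0E.
by move=> a aI; rewrite xr // !linear0.
Qed.

End KernelBraid.

(** * Functors presented by cogenerators and equations *)

Section KernelPresentations.
Variables (K : fieldType) (Q : quiver) (I : {set Q}).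
Local Notation rep := (rep K (double Q)).
Local Notation family V W := (forall k : Q, {linear V k -> W k}).
Implicit Types (u v w k l : Q).

Definition kout (V X : rep) (g : family V X) v (x : X v) (r : oplus v V)
    (s : forall w, oplus w V) : Prop :=
  oeq I (mu v X x) (omapf g v r) /\
  forall w (b : darr v w), w \in I ->
    oeq I (mu w X (rmap X b x)) (omapf g w (s w)).

Lemma only_star v w w' (b : darr w v) (b' : darr v w') :
  only I b -> w' \in I -> exists e : w' = w, ecast z (darr v z) e b' = star b.
Proof.
move=> ob wI; have [e <-] := only_tag (star b') ob wI.
by case: w / e b ob => b ob; exists erefl; rewrite /= starK.
Qed.

Lemma kout_only (V X : rep) (g : family V X) v w (b : darr w v) (x : X v)
    (r : oplus v V) s : only I b -> w \in I ->
  kout g x r s <-> oeq I (mu v X x) (omapf g v r) /\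
    oeq I (mu w X (rmap X (star b) x)) (omapf g w (s w)).
Proof.
move=> ob wI; split=> [[xr xs]|[xr xs]]; split=> //; first exact: xs.
move=> w' b' w'I; have [e eb] := only_star b' ob w'I.
by subst w'; rewrite /= in eb; rewrite eb.
Qed.

(* The kernel of R + S -> V_w; only one pair (w, b) contributes. *)
Definition braid_im (V : rep) v (r : oplus v V) (s : forall w, oplus w V) : Prop :=
  forall w (b : darr v w), w \in I ->
    opi I w V (s w) + rmap V b (opi I v V r) = 0.

Lemma braid_imP (V : rep) v w (b : darr w v) (r : oplus v V) s :
  only I b -> w \in I ->
  braid_im r s <-> opi I w V (s w) + rmap V (star b) (opi I v V r) = 0.
Proof.
move=> ob wI; split=> [|e w' b' w'I]; first exact.
have [ew eb] := only_star b' ob w'I.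
by subst w'; rewrite /= in eb; rewrite eb.
Qed.

Section Related.
Variables (nu : Q -> K) (V X Y : rep) (g : family V X) (g' : family V Y).
Variables (h : family X V) (h' : family Y V).
Hypotheses (Xf : frame I nu g h) (Yf : frame I nu g' h').

Lemma kout_krel v (x : X v) (y : Y v) (r : oplus v V) s :
  kout g x r s -> kout g' y r s -> v \in I -> krel I h h' x y.
Proof.
have hE k z : k \notin I -> h k (g k z) = h' k (g' k z).
  by move=> kI; rewrite (frame_gK Xf) // (frame_gK Yf).
move=> [xr xs] [yr ys] vI; split=> [|_]; first by rewrite vI.
split=> [k a|w k b a wI]; (have [kI|kI] := boolP (k \in I);
    first by rewrite (frame_h0 Xf) // (frame_h0 Yf)).
  have := xr (to_into (star a)) kI; have := yr (to_into (star a)) kI.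
  by rewrite !muE !omapfE /= starK => -> ->; apply: hE.
have := xs w b wI (to_into (star a)) kI; have := ys w b wI (to_into (star a)) kI.
by rewrite !muE !omapfE /= starK => -> ->; apply: hE.
Qed.

Lemma krel0_kout v (y : Y v) : v \in I -> krel I h h' 0 y ->
  kout g' y 0 (fun=> 0).
Proof.
move=> vI [_ /(_ vI)[y1 y2]]; split=> [a aI|w b wI a aI].
  rewrite muE omapfE dsum0E linear0 -(frame_hK Yf aI (rmap _ _ _)) -y1.
  by rewrite !linear0.
rewrite muE omapfE dsum0E linear0 -(frame_hK Yf aI (rmap _ _ _)) -y2 //.
by rewrite !linear0.
Qed.

Lemma kout_ex v (x : X v) : inner_unique I -> v \in I ->
  exists r s, kout g x r s.
Proof.
move=> iu vI; exists (omapf h v (mu v X x)).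
(* For [w] in [I] this sum has at most one term; it selects the inner arrow if there is one and
   gives 0 otherwise. *)
exists (fun w => \sum_(b : darr v w) omapf h w (mu w X (rmap X b x))).
split=> [a aI|w b wI]; first by rewrite !omapfE (frame_hK Xf).
rewrite (big_pred1 b) => [a aI|c]; first by rewrite !omapfE (frame_hK Xf).
have /eqP : to_into (star c) = to_into (star b) by apply: (iu v).
rewrite eq_Tagged /= => /eqP/(congr1 (@star _ _ _)); rewrite !starK => ->.
by rewrite eqxx.
Qed.

End Related.

Lemma krelC (V X Y : rep) (h : family X V) (h' : family Y V) v (x : X v) (y : Y v) :
  krel I h h' x y -> krel I h' h y x.
Proof.
move=> [xyo xyi]; split=> [/xyo //|/xyi[xy1 xy2]].
by split=> [k a|w k b a wI]; rewrite ?xy1 ?xy2.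
Qed.

Variables (nu : Q -> K) (lam mu : {ffun Q -> K}).
Implicit Types F G : functor (ModPi lam) (ModPi mu).

(** Naturality is asked of [h], since here elements are determined by their images outside [I]. The
    subspace [Im] depends on V alone. *)
Definition ker_presented
    (Im : forall (V : pirep lam) v, oplus v V -> (forall w, oplus w V) -> Prop)
    F : Prop :=
  exists (g : forall V : pirep lam, family V (F V : pirep mu))
         (h : forall V : pirep lam, family (F V : pirep mu) V),
  [/\ forall V, frame I nu (g V) (h V),
      forall (V W : pirep lam) (f : rhom V W) k x,
        h W k ((fmap F (f : chom (V : ModPi lam) W) : rhom _ _) k x) =
          f k (h V k x),
      forall V v x, v \in I -> kout (g V) (v := v) x 0 (fun=> 0) -> x = 0
    & forall V v r s, v \in I ->
        (exists x, kout (g V) (v := v) x r s) <-> Im V v r s].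

Lemma ker_presented_iso Im F G : inner_unique I ->
  ker_presented Im F -> ker_presented Im G -> functor_iso F G.
Proof.
move=> iu [g [h [fg nat inj im]]] [g' [h' [fg' nat' inj' im']]].
pose rho (V : pirep lam) v (x : (F V : pirep mu) v) (y : (G V : pirep mu) v) :=
  krel I (h V) (h' V) x y.
apply: (@functor_iso_linrel _ _ _ _ F G rho) => [V|V|V W f v x y [xyo xyi]].
- apply: (krel_linrel iu (fg V) (fg' V) (@pirepP _ _ _ _) (@pirepP _ _ _ _)).
    move=> v x vI; have [r [s xrs]] := kout_ex (fg V) x iu vI.
    (* The outer data of x lie in the common image, hence are those of some y. *)
    have /im'[//|y yrs] : Im V v r s by apply/im => //; exists x.
    by exists y; apply: (kout_krel (fg V) (fg' V) xrs yrs).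
  by move=> v y vI /(krel0_kout (fg' V) vI)/inj'; apply.
- apply: (@linrel_iff _ _ _ _
    (fun v (y : (G V : pirep mu) v) x => krel I (h' V) (h V) y x)).
    by move=> v x y; split=> /krelC.
  apply: (krel_linrel iu (fg' V) (fg V) (@pirepP _ _ _ _) (@pirepP _ _ _ _)).
    move=> v x vI; have [r [s xrs]] := kout_ex (fg' V) x iu vI.
    have /im[//|y yrs] : Im V v r s by apply/im' => //; exists x.
    by exists y; apply: (kout_krel (fg' V) (fg V) xrs yrs).
  by move=> v y vI /(krel0_kout (fg V) vI)/inj; apply.
split=> [/xyo xy|/xyi[xy1 xy2]]; first by rewrite nat nat' xy.
split=> [k a|w k b a wI].
  by rewrite -!rhP nat nat' xy1.
by rewrite -!rhP nat nat' xy2.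
Qed.

End KernelPresentations.

Section KernelPair.
Variables (K : fieldType) (Q : quiver) (i j : Q).
Local Notation rep := (rep K (double Q)).
Local Notation family V W := (forall k : Q, {linear V k -> W k}).
Local Notation I := [set i; j].
Hypotheses (ij : i != j).
Hypothesis no : forall v, v \in I -> forall a : into v, tag a \notin I.
Variables (V V1 V2 : rep) (l1 l2 : K).
Variables (e1 : family V V1) (h1 : family V1 V).
Variables (e2 : family V1 V2) (h2 : family V2 V1).
Hypotheses (s1 : step j l1 e1 h1) (s2 : step i l2 e2 h2).
Hypotheses (k1 : ker_exact j e1) (k2 : ker_exact i e2).

Let iI : i \in I. Proof. by rewrite set21. Qed.
Let jI : j \in I. Proof. by rewrite set22. Qed.
Let ji : j != i. Proof. by rewrite eq_sym. Qed.
Let noi := no iI.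
Let noj := no jI.

Let mu_e2 x : mu j V2 (e2 j x) = omapf e2 j (mu j V1 x).
Proof. exact/(oeq_eq noj)/(step_mu iI s2). Qed.

Lemma ker_pair_inj (v : Q) (x : V2 v) : v \in I -> mu v V2 x = 0 -> x = 0.
Proof.
case/set2P => ?; subst v; first exact: k2.1.
rewrite -(step_hK s2 ij x) mu_e2 => m0; suff -> : h2 j x = 0 by rewrite linear0.
apply: k1.1; apply: (oeq_eq noj); apply: (omapf_inj iI s2).
by rewrite m0 linear0.
Qed.

Lemma ker_pair_im (v : Q) (r : oplus v V) : v \in I ->
  (exists x, mu v V2 x = omapf (famcomp e2 e1) v r) <-> pi v V r = 0.
Proof.
case/set2P => ?; subst v; rewrite omapf_famcomp.
  have piE : pi i V1 (omapf e1 i r) = e1 i (pi i V r).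
    by rewrite (pi_opi noi) (step_opi jI s1) // -(pi_opi noi).
  split=> [[x xr]|r0].
    rewrite -(step_eK s1 ji (pi i V r)) -piE (k2.2 _).2 ?linear0 //.
    by exists x.
  by have [|x xr] := (k2.2 (omapf e1 i r)).1; [rewrite piE r0 linear0 | exists x].
apply: iff_trans (iff_sym (k1.2 _)); split=> [[x xr]|[x xr]]; last first.
  by exists (e2 j x); rewrite mu_e2 -xr.
exists (h2 j x); apply: (oeq_eq noj); apply: (omapf_inj iI s2).
by rewrite -mu_e2 (step_hK s2) // xr.
Qed.

End KernelPair.

(** * Presentations of the composite kernel functors *)

Section KernelComposites.
Variables (K : fieldType) (Q : quiver).
Local Notation rep := (rep K (double Q)).
Local Notation family V W := (forall k : Q, {linear V k -> W k}).

Section Kept.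
Variables (i : Q) (li : loopfree i) (lam : {ffun Q -> K}).

Definition ker_keep (V : pirep lam) : family V (ker_obj li V) :=
  keep (kgamma i V) (kincl (pi i V)).
Definition ker_back (V : pirep lam) : family (ker_obj li V) V :=
  back (kgamma i V) (kincl (pi i V)).

Lemma ker_back_natural (V W : pirep lam) (f : rhom V W) (k : Q) x :
  ker_back W k (ker_map li f k x) = f k (ker_back V k x).
Proof. exact: replace_map_at_back. Qed.

Lemma ker_step V : step i (lam i) (ker_keep V) (ker_back V).
Proof. exact/step_replace/kgammaE. Qed.

Lemma ker_keep_exact V : ker_exact i (ker_keep V).
Proof. exact: ker_stepP. Qed.

End Kept.

Lemma ker_presented_cast I nu (lam m m' : {ffun Q -> K}) (e : m = m') Im
    (F : functor (ModPi lam) (ModPi m)) :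
  ker_presented I nu Im F -> ker_presented I nu Im (mod_cast e \of F).
Proof. by move=> [g [h P]]; exists g, h. Qed.

Lemma ker_presented_commute (i j : Q) (li : loopfree i) (lj : loopfree j) (lam : {ffun Q -> K}) :
  i != j -> #|arrows_between i j| = 0%N ->
  ker_presented [set i; j] lam (fun V v r _ => pi v V r = 0)
    (ker_refl (wrefl j lam) li \of ker_refl lam lj).
Proof.
move=> ij no; have no' : #|darr i j| = 0%N by rewrite -card_arrows_between.
have si : wrefl j lam i = lam i.
  by rewrite wreflE symformC symform_neq // no oppr0 mul0r subr0.
exists (fun V => famcomp (ker_keep li (ker_obj lj V)) (ker_keep lj V)).
exists (fun V => famcomp (ker_back lj V) (ker_back li (ker_obj lj V))).
have out := no_inner li lj no'.
split=> [V|V W f k x|V v x vI [m0 _]|V v r s vI].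
- apply: frame_two => //; first exact: ker_step.
  by rewrite -si; apply: ker_step.
- have n1 := ker_back_natural (li := li) (ker_map lj f) x.
  have n2 := ker_back_natural (li := lj) f (ker_back li (ker_obj lj V) k x).
  exact: etrans (congr1 (ker_back lj W k) n1) n2.
- have inj := ker_pair_inj ij out (ker_step li (ker_obj lj V))
    (ker_keep_exact lj V) (ker_keep_exact li _) vI.
  by apply: inj; rewrite (oeq_eq (out _ vI) m0) linear0.
apply: iff_trans (ker_pair_im ij out (ker_step lj V) (ker_step li _)
    (ker_keep_exact lj V) (ker_keep_exact li _) r vI).
split=> [[x [xr _]]|[x xr]]; exists x; first exact: (oeq_eq (out _ vI)).
split=> [a aI|w b wI]; first by rewrite xr.
by have := out _ vI (to_into (star b)); rewrite /= wI.
Qed.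

Lemma ker_presented_braid (i j : Q) (li : loopfree i) (lj : loopfree j)
    (lam : {ffun Q -> K}) :
  i != j -> #|arrows_between i j| = 1%N ->
  ker_presented [set i; j] (fun=> lam i + lam j)
    (fun V v r s => braid_im [set i; j] r s)
    (ker_refl (wrefl j (wrefl i lam)) li \of ker_refl (wrefl i lam) lj
       \of ker_refl lam li).
Proof.
move=> ij one; have one' : #|darr i j| = 1%N by rewrite -card_arrows_between.
have /card_gt0P[b _] : (0 < #|darr j i|)%N by rewrite card_darrC one'.
have ob : only [set i; j] b by apply: only_single; rewrite // card_darrC.
have obs : only [set i; j] (star b) by rewrite setUC; apply: only_single.
have cij := symform_neq K ij; have cji := symformC K j i; rewrite cij one in cji.
have l2 : wrefl i lam j = lam i + lam j by rewrite wreflE cij one; ring.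
have l3 : lam i + wrefl j (wrefl i lam) i = lam i + lam j.
  by rewrite wreflE l2 cji wreflE symform_loopfree //; ring.
pose V1 (V : pirep lam) := ker_obj li V.
pose V2 (V : pirep lam) := ker_obj lj (V1 V).
pose g V := famcomp (ker_keep li (V2 V))
  (famcomp (ker_keep lj (V1 V)) (ker_keep li V)).
pose h V := famcomp (ker_back li V)
  (famcomp (ker_back lj (V1 V)) (ker_back li (V2 V))).
exists g, h.
have ji : j != i by rewrite eq_sym.
have iI : i \in [set i; j] by rewrite set21.
have jI : j \in [set i; j] by rewrite set22.
have kout_i (V : pirep lam) x (r : oplus i V) (s : forall w, oplus w V) :
    kout [set i; j] (g V) x r s <->
    out3 b (ker_keep li V) (ker_keep lj (V1 V)) (ker_keep li (V2 V)) x r (s j).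
  by apply: iff_trans (kout_only _ _ _ _ ob jI) _; rewrite !omapf_famcomp.
(* The third reflection is an identification at [j]; removing it from the outer components leaves
   the conditions of [out2]. *)
have kout_j (V : pirep lam) x (r : oplus j V) (s : forall w, oplus w V) :
    kout [set i; j] (g V) x r s <->
    out2 b (ker_keep li V) (ker_keep lj (V1 V)) (ker_back li (V2 V) j x) (s i) r.
  apply: iff_trans (kout_only _ _ _ _ obs iI) _; rewrite !omapf_famcomp starK.
  have st := ker_step li (V2 V).
  rewrite -{1 2}(step_hK st ij x); split=> [[xr xs]|[xr xs]].
    split; apply: (omapf_inj iI st) => a aI.
      by rewrite -(step_mu iI st) // xr.
    by rewrite -(step_mu_arr st _ _ jI) // xs.
  split=> a aI; first by rewrite (step_mu iI st) // (omapf_oeq _ xr).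
  by rewrite (step_mu_arr st _ _ jI) // (omapf_oeq _ xs).
split=> [V|V W f k x|V v x vI|V v r s vI].
- apply: (frame_three ij li lj (ker_step _ _) _ (ker_step _ _) l3).
  by rewrite -l2; apply: ker_step.
- have n1 := ker_back_natural (li := li) (ker_map lj (ker_map li f)) x.
  set x1 := ker_back li (V2 V) k x in n1.
  have n2 := ker_back_natural (li := lj) (ker_map li f) x1.
  have n3 := ker_back_natural (li := li) f (ker_back lj (V1 V) k x1).
  apply: etrans (congr1 (ker_back li W k) _) n3.
  exact: etrans (congr1 (ker_back lj (V1 W) k) n1) n2.
- case/set2P: vI => ?; subst v.
    move=> /kout_i; exact: (out3_inj ij ob obs (ker_step lj (V1 V)) (ker_step li (V2 V))
      (ker_keep_exact li V) (ker_keep_exact lj (V1 V)) (ker_keep_exact li (V2 V))).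
  move=> /kout_j/(out2_inj ij ob obs (ker_step lj (V1 V)) (ker_keep_exact li V)
    (ker_keep_exact lj (V1 V))) x0.
  by rewrite -(step_hK (ker_step li (V2 V)) ij x) x0 linear0.
case/set2P: vI => ?; subst v.
  apply: iff_trans (iff_sym (braid_imP _ _ ob jI)).
  apply: iff_trans (out3_im ij ob obs (ker_step li V) (ker_step lj (V1 V))
    (ker_step li (V2 V)) (ker_keep_exact lj (V1 V)) (ker_keep_exact li (V2 V)) _ _).
  by split=> -[x /kout_i xr]; exists x.
apply: iff_trans (iff_sym (braid_imP _ _ obs iI)); rewrite starK.
apply: iff_trans (out2_im ij ob obs (ker_step li V) (ker_step lj (V1 V))
    (ker_keep_exact li V) (ker_keep_exact lj (V1 V)) _ _).
split=> [[x /kout_j xr]|[x xr]]; first by exists (ker_back li (V2 V) j x).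
exists (ker_keep li (V2 V) j x); apply/kout_j.
by rewrite (step_eK (ker_step li (V2 V)) ij).
Qed.

End KernelComposites.

(** Serves the degenerate case [i = j], where both composites are the same functor up to the
    cast. *)
Lemma functor_iso_cast (C : category) (K : fieldType) (Q : quiver)
    (m : {ffun Q -> K}) (e : m = m) (F : functor C (ModPi m)) :
  functor_iso (mod_cast e \of F) F.
Proof.
exists (fun x => rid (F x : pirep m)); split=> [x|x y f]; last exact: rhom_ext.
by exists (rid (F x : pirep m)); split; apply: rhom_ext.
Qed.

Theorem theorem1p3 (K : fieldType) (Q : quiver) (i j : Q)
    (li : loopfree i) (lj : loopfree j) (lam : {ffun Q -> K}) :
  (forall no_arrow : #|arrows_between i j| = 0%N,
     functor_iso
       (mod_cast (wrefl_comm lam no_arrow)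
          \of (cok_refl (wrefl j lam) li \of cok_refl lam lj))
       (cok_refl (wrefl i lam) lj \of cok_refl lam li)
     /\
     functor_iso
       (mod_cast (wrefl_comm lam no_arrow)
          \of (ker_refl (wrefl j lam) li \of ker_refl lam lj))
       (ker_refl (wrefl i lam) lj \of ker_refl lam li))
  /\
  (forall one_arrow : #|arrows_between i j| = 1%N,
     functor_iso
       (mod_cast (wrefl_braid li lj lam one_arrow)
          \of (cok_refl (wrefl j (wrefl i lam)) li
                 \of cok_refl (wrefl i lam) lj \of cok_refl lam li))
       (cok_refl (wrefl i (wrefl j lam)) lj
          \of cok_refl (wrefl j lam) li \of cok_refl lam lj)
     /\
     functor_iso
       (mod_cast (wrefl_braid li lj lam one_arrow)
          \of (ker_refl (wrefl j (wrefl i lam)) li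
                 \of ker_refl (wrefl i lam) lj \of ker_refl lam li))
       (ker_refl (wrefl i (wrefl j lam)) lj
          \of ker_refl (wrefl j lam) li \of ker_refl lam lj)).
Proof.
have sw : #|arrows_between j i| = #|arrows_between i j|.
  by apply: eq_card => a; rewrite !inE orbC.
(* If [i = j], loop-freeness leaves no arrow between them: the first part compares equal composites
   and the second is void. *)
have [ij|ij] := eqVneq i j.
  subst j; rewrite (Prop_irrelevance lj li); split=> [no|one].
    by split; apply: functor_iso_cast.
  exfalso; suff no : #|arrows_between i i| = 0%N by have := one; rewrite no.
  by apply: eq_card0 => a; rewrite !inE orbb; apply/negbTE/li.
have ji : j != i by rewrite eq_sym.
split=> [no|one].
  have iu : inner_unique [set i; j].
    move=> v c c' vI cI; have no' : #|darr i j| = 0%N by rewrite -card_arrows_between.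
    by rewrite (negbTE (no_inner li lj no' vI c)) in cI.
  have no' := no; rewrite -sw in no'; split.
    apply: (cok_presented_iso iu (cok_presented_cast _ (cok_presented_commute li lj lam ij no))).
    (* The other composite has the same presentation with [i] and [j] exchanged. *)
    by rewrite setUC; apply: cok_presented_commute.
  apply: (ker_presented_iso iu (ker_presented_cast _ (ker_presented_commute li lj lam ij no))).
  by rewrite setUC; apply: ker_presented_commute.
have one' := one; rewrite -sw in one'.
have darr1 : #|darr i j| = 1%N by rewrite -card_arrows_between.
have /card_gt0P[b _] : (0 < #|darr j i|)%N by rewrite card_darrC darr1.
have iu : inner_unique [set i; j].
  apply: (inner_unique_single (b := b) (b' := star b)).
    by apply: only_single; rewrite // card_darrC.
  by rewrite setUC; apply: only_single.
split.
  apply: (cok_presented_iso iu (cok_presented_cast _ (cok_presented_braid li lj lam ij one))).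
  by rewrite setUC (addrC (lam i)); apply: cok_presented_braid.
apply: (ker_presented_iso iu (ker_presented_cast _ (ker_presented_braid li lj lam ij one))).
by rewrite setUC (addrC (lam i)); apply: ker_presented_braid.
Qed.
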